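(* (a) For any $m,d\ge1$: if $f:\{0,1\}^m\to[0,1]$ has $\deg_{\mathsf{sos}}(f)=d+2$, then for all $n\ge 2m$, $$1+n^{1+d/2}\ge\mathrm{rk}_{\mathsf{psd}}(M_n^f)\ge C_f\left(\frac{n}{\log n}\right)^{d/4},$$ where $C_f>0$ depends only on $f$. (b) Moreover, for $f:\{0,1\}^m\to[0,1]$ and $m,d\ge1$, if there exist $\epsilon\in(0,1]$ and a degree-$d$ pseudo-density $D:\{0,1\}^m\to\mathbb{R}$ with $\mathbb E_xD(x)f(x)<-\epsilon$, then for every $n\ge2m$, $$\mathrm{rk}_{\mathsf{psd}}(M_n^f)\ge\left(\frac{c\,\epsilon\,n}{d\,m^2\|D\|_\infty\log n}\right)^{d/4}\left(\frac{\epsilon}{\|D\|_\infty}\right)^{3/2}\sqrt{\mathbb E_xf(x)},$$ where $c>0$ is a universal constant.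
   Context: The degree of a function on $\{0,1\}^m$ is the degree of its unique multilinear polynomial representation. $\deg_{\mathsf{sos}}(f)$ for nonnegative $f$ is the minimal $d'$ such that $f=\sum_{i}g_i^2$ on $\{0,1\}^m$ with all $\deg(g_i)\le d'/2$. A degree-$d$ pseudo-density is $D:\{0,1\}^m\to\mathbb{R}$ with $\mathbb E_xD(x)=1$ and $\mathbb E_xD(x)g(x)^2\ge0$ for every $g$ of degree at most $d/2$ (uniform expectations); $\|D\|_\infty=\max|D|$. $M_n^f$ is the $\binom nm\times 2^n$ matrix indexed by $m$-subsets $S\subseteq[n]$ and $x\in\{0,1\}^n$ with $M_n^f(S,x)=f(x_S)$, where $x_S$ lists the coordinates of $x$ in $S$ in increasing order. $\mathrm{rk}_{\mathsf{psd}}$ of a nonnegative matrix is the smallest $r$ with entries $\mathrm{Tr}(A_iB_j)$ for symmetric psd $r\times r$ matrices $A_i,B_j$. *)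

(* Defs.v *)
From mathcomp Require Import all_boot all_order all_algebra.
From mathcomp Require Import all_classical all_reals all_analysis.

Set Implicit Arguments.
Unset Strict Implicit.
Unset Printing Implicit Defensive.

Import Order.TTheory GRing.Theory Num.Theory.

Local Open Scope ring_scope.

(* The default value 0 is irrelevant as soon as P is satisfiable, see minnatP. *)
Definition minnat (P : nat -> Prop) : nat :=
  xget 0%N [set k | P k /\ forall j, P j -> (k <= j)%N]%classic.

Lemma minnatP (P : nat -> Prop) : (exists k, P k) ->
  P (minnat P) /\ forall j, P j -> (minnat P <= j)%N.
Proof.
move=> [k Pk]; rewrite /minnat.
have exP : exists k, `[< P k >] by exists k; apply/asboolP.
apply: (@xgetPex _ 0%N [set k | P k /\ forall j, P j -> (k <= j)%N]%classic).
case: (ex_minnP exP) => l /asboolP Pl lmin; exists l; split=> // j Pj.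
by apply: lmin; apply/asboolP.
Qed.

Definition cube (m : nat) : finType := {ffun 'I_m -> bool}.

Definition cube_mean (R : realType) (m : nat) (g : cube m -> R) : R :=
  (\sum_(x : cube m) g x) / #|cube m|%:R.

Definition cube_maxnorm (R : realType) (m : nat) (g : cube m -> R) : R :=
  \big[Num.max/0]_(x : cube m) `|g x|.

(* A multilinear polynomial is given by its coefficients c A on the monomials
   \prod_(i in A) x_i, for A a set of variables. *)
Definition ml_eval (R : realType) (m : nat) (c : {set 'I_m} -> R)
    (x : cube m) : R :=
  \sum_(A : {set 'I_m}) c A * \prod_(i in A) (x i)%:R.

Definition indic (m : nat) (A : {set 'I_m}) : cube m := [ffun i => i \in A].

(* The coefficients of the multilinear polynomial representing f, by Moebius
   inversion; ml_coefK and ml_coef_uniq state that it is indeed the unique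
   multilinear polynomial representing f. *)
Definition ml_coef (R : realType) (m : nat) (f : cube m -> R)
    (A : {set 'I_m}) : R :=
  \sum_(B : {set 'I_m} | B \subset A) (-1) ^+ #|A :\: B| * f (indic B).

Lemma prod_indic (R : realType) (m : nat) (S A : {set 'I_m}) :
  \prod_(i in A) (indic S i)%:R = (A \subset S)%:R :> R.
Proof.
case: (boolP (A \subset S)) => [/fintype.subsetP AS|/fintype.subsetPn[i iA iS]].
  by rewrite big1 // => i iA; rewrite ffunE AS.
by rewrite (bigD1 i) //= ffunE (negbTE iS) mul0r.
Qed.

Lemma ml_eval_indic (R : realType) (m : nat) (c : {set 'I_m} -> R)
    (S : {set 'I_m}) :
  ml_eval c (indic S) = \sum_(A : {set 'I_m} | A \subset S) c A.
Proof.
rewrite [RHS]big_mkcond; apply: eq_bigr => A _; rewrite prod_indic.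
by case: (A \subset S); rewrite ?mulr1 ?mulr0.
Qed.

Lemma indic_surj (m : nat) (x : cube m) : x = indic [set i | x i]%SET.
Proof. by apply/ffunP => i; rewrite ffunE inE. Qed.

Lemma moebius_sum (R : realType) (m : nat) (S B : {set 'I_m}) :
  \sum_(A : {set 'I_m} | (A \subset S) && (B \subset A)) (-1) ^+ #|A :\: B|
    = (B == S)%:R :> R.
Proof.
pose F i : R := (i \in S)%:R * (-1) ^+ (i \notin B).
pose G i : R := (i \notin B)%:R.
transitivity (\prod_i (F i + G i)).
  rewrite bigA_distr big_mkcond; apply: eq_bigr => A _.
  case: (boolP (A \subset S)) => [/fintype.subsetP AS|/fintype.subsetPn[i iA iS]] /=; last first.
    by rewrite (bigD1 i) //= iA /F (negbTE iS) !mul0r.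
  case: (boolP (B \subset A)) => [/fintype.subsetP BA|/fintype.subsetPn[i iB iA]] /=; last first.
    by rewrite (bigD1 i) //= (negbTE iA) /G iB mul0r.
  rewrite -prodr_const big_mkcond; apply: eq_bigr => i _.
  rewrite inE /F /G; case: (boolP (i \in A)) => iA; last first.
    by case: (boolP (i \in B)) => // iB; rewrite (BA _ iB) in iA.
  by rewrite AS // mul1r; case: (i \in B); rewrite ?expr0 ?expr1.
case: eqP => [eqBS|/eqP neq].
  by rewrite big1 // => i _; rewrite /F /G eqBS; case: (i \in S);
    rewrite /= ?expr0 ?expr1 ?mul1r ?mul0r ?addr0 ?add0r.
have [i /negbTE idiff] : exists i, (i \in B) != (i \in S).
  apply/existsP; apply: contraT; rewrite negb_exists => /forallP eqBS.
  case/negP: neq; apply/eqP/finset.setP => i.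
  by have := eqBS i; rewrite negbK => /eqP.
rewrite (bigD1 i) //= /F /G; move: idiff.
by case: (i \in B); case: (i \in S) => //= _;
  rewrite ?expr0 ?expr1 ?mul1r ?mul0r ?addr0 ?add0r ?addNr ?mul0r.
Qed.

Lemma ml_coefK (R : realType) (m : nat) (f : cube m -> R) :
  ml_eval (ml_coef f) =1 f.
Proof.
move=> x; rewrite [x]indic_surj; set S := [set i | x i]%SET.
rewrite ml_eval_indic /ml_coef.
rewrite (exchange_big_dep predT) //=.
under eq_bigr do rewrite -mulr_suml moebius_sum.
rewrite (bigD1 S) //= eqxx mul1r big1 ?addr0 // => B /negbTE ->.
by rewrite mul0r.
Qed.

Lemma ml_coef_uniq (R : realType) (m : nat) (f : cube m -> R)
    (c : {set 'I_m} -> R) :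
  ml_eval c =1 f -> c =1 ml_coef f.
Proof.
move=> cf A; have [k] := ubnP #|A|; elim: k A => // k IH A ltk.
have := etrans (cf (indic A)) (esym (ml_coefK f (indic A))).
rewrite !ml_eval_indic.
rewrite (bigD1 A) //= [in RHS](bigD1 A) //=.
rewrite (eq_bigr (ml_coef f)); first exact: addIr.
move=> B /andP[BA neqBA]; apply: IH; rewrite -ltnS (leq_trans _ ltk) //.
by rewrite ltnS proper_card // finset.properEneq neqBA.
Qed.

(* The degree of the zero function is 0 by convention. *)
Definition cube_deg (R : realType) (m : nat) (f : cube m -> R) : nat :=
  \max_(A : {set 'I_m} | ml_coef f A != 0) #|A|.

Lemma cube_deg_le (R : realType) (m : nat) (f : cube m -> R) :
  (cube_deg f <= m)%N.
Proof.
by apply/bigmax_leqP => A _; rewrite -[X in (_ <= X)%N]card_ord max_card.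
Qed.

(* deg (g i) <= d / 2 is written 2 * deg (g i) <= d, also for odd d. *)
Definition has_sos (R : realType) (m : nat) (f : cube m -> R) (d : nat) : Prop :=
  exists (k : nat) (g : 'I_k -> cube m -> R),
    (forall i, (2 * cube_deg (g i) <= d)%N) /\
    (forall x, f x = \sum_(i < k) g i x ^+ 2).

Definition deg_sos (R : realType) (m : nat) (f : cube m -> R) : nat :=
  minnat (has_sos f).

Lemma has_sos_ex (R : realType) (m : nat) (f : cube m -> R) :
  (forall x, 0 <= f x) -> exists d, has_sos f d.
Proof.
move=> f0; exists (2 * m)%N, 1%N, (fun _ x => Num.sqrt (f x)); split=> [_|x].
  by rewrite leq_mul2l cube_deg_le.
by rewrite big_ord1 sqr_sqrtr.
Qed.

Definition pseudo_density (R : realType) (m d : nat) (D : cube m -> R) : Prop :=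
  cube_mean D = 1 /\
  forall g : cube m -> R, (2 * cube_deg g <= d)%N ->
    0 <= cube_mean (fun x => D x * g x ^+ 2).

Definition psdmx (R : realType) (r : nat) (A : 'M[R]_r) : Prop :=
  A^T = A /\ forall v : 'rV[R]_r, 0 <= (v *m A *m v^T) 0 0.

Definition psd_factor (R : realType) (I J : finType) (M : I -> J -> R)
    (r : nat) : Prop :=
  exists (A : I -> 'M[R]_r) (B : J -> 'M[R]_r),
    (forall i, psdmx (A i)) /\ (forall j, psdmx (B j)) /\
    (forall i j, M i j = \tr (A i *m B j)).

Definition rk_psd (R : realType) (I J : finType) (M : I -> J -> R) : nat :=
  minnat (psd_factor M).

Lemma psdmx_diag (R : realType) (r : nat) (a : 'rV[R]_r) :
  (forall k, 0 <= a 0 k) -> psdmx (diag_mx a).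
Proof.
move=> a0; split=> [|v]; first exact: tr_diag_mx.
rewrite mul_mx_diag mxE sumr_ge0 // => k _.
by rewrite !mxE mulrAC -expr2 mulr_ge0 // sqr_ge0.
Qed.

Lemma psd_factor_ex (R : realType) (I J : finType) (M : I -> J -> R) :
  (forall i j, 0 <= M i j) -> exists r, psd_factor M r.
Proof.
move=> M0; exists #|J|.
exists (fun i => diag_mx (\row_k M i (enum_val k))).
exists (fun j => diag_mx (\row_k (k == enum_rank j)%:R)).
split=> [i|]; first by apply: psdmx_diag => k; rewrite mxE.
split=> [j|i j]; first by apply: psdmx_diag => k; rewrite mxE ler0n.
rewrite mulmx_diag mxtrace_diag (bigD1 (enum_rank j)) //= !mxE eqxx mulr1.
rewrite enum_rankK big1 ?addr0 // => k /negbTE nk.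
by rewrite !mxE nk mulr0.
Qed.

Definition msubset (n m : nat) : finType := {S : {set 'I_n} | #|S| == m}.

(* The element of rank i of S, in increasing order, see msubset_nth_mono. *)
Definition msubset_nth (n m : nat) (S : msubset n m) (i : 'I_m) : 'I_n :=
  enum_val (cast_ord (esym (eqP (valP S))) i).

Lemma msubset_nth_in (n m : nat) (S : msubset n m) (i : 'I_m) :
  msubset_nth S i \in val S.
Proof. exact: enum_valP. Qed.

Lemma enum_val_mono (n : nat) (S : {set 'I_n}) (i j : 'I_#|S|) :
  (i < j)%N -> (enum_val i < enum_val j)%N.
Proof.
move=> ij.
have srt : sorted ltn (map val (enum S)).
  rewrite -[enum _](eq_filter (mem_enum _)).
  rewrite -(eq_filter (mem_map val_inj _)) -filter_map.
  by rewrite (sorted_filter ltn_trans) // unlock val_ord_enum iota_ltn_sorted.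
have sz (k : 'I_#|S|) : (k < size (enum S))%N by rewrite -cardE.
have x0 := enum_val i.
rewrite (enum_val_nth x0 i) (enum_val_nth x0 j).
rewrite -(nth_map x0 0%N val (sz i)) -(nth_map x0 0%N val (sz j)).
by apply: (sorted_ltn_nth ltn_trans 0%N srt); rewrite ?inE ?size_map ?sz.
Qed.

Lemma msubset_nth_mono (n m : nat) (S : msubset n m) (i j : 'I_m) :
  (i < j)%N -> (msubset_nth S i < msubset_nth S j)%N.
Proof. by move=> ij; exact: enum_val_mono. Qed.

Definition restrict (n m : nat) (S : msubset n m) (x : cube n) : cube m :=
  [ffun i => x (msubset_nth S i)].

Definition pattern_mx (R : realType) (m : nat) (f : cube m -> R) (n : nat)
    (S : msubset n m) (x : cube n) : R :=
  f (restrict S x).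

Arguments pattern_mx {R m} f n S x.

(* Main.v *)
(* In (a) the upper bound expands a sum-of-squares certificate in the monomials
   of degree at most k = 1 + d/2, of which there are at most 1 + n^k.  The lower
   bound follows from (b): if p is the degree-d sum of squares nearest to f in
   L^2, then p - f, shifted by a small constant and normalised, is a
   pseudo-density with E D f < 0.

   For (b), let Tr (A_S B_x) = f (x_S) be a factorization of size r and put
   N = |D|_oo, Λ(x) = E_S D(x_S) A_S, X = 1 - Λ/N.  An almost determinant
   maximal (Auerbach) basis and a change of coordinates give E_S A_S <= 1,
   A_S <= 4 r^2 and Tr B_x <= 4, so that 0 <= X <= 2.  As E Tr (Λ B) < - eps,
   log-convexity of j |-> E Tr (B X^j) forces E Tr (B X^(2k)), hence
   E Tr X^(2k), to be at least of order (1 + eps / 4N)^(2k) eps / N.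
   On the other hand X^k has Fourier degree at most k m, and a random m-set S
   meets a set of size at most k m in more than d/2 points with probability at
   most q = (k m^2 / n)^(d/2).  So conditionally on the bits outside S the
   entries of X^k are nearly of degree at most d/2, and the pseudo-density
   property gives E Tr (Λ X^(2k)) >= - N delta E Tr X^(2k) with delta small as
   soon as r^2 q is small against (eps / N)^2; log-convexity then bounds
   E Tr X^(2k) by r (1 + delta)^(2k).  Taking k of order (N / eps) d ln n makes
   the two bounds incompatible unless r is large. *)

From mathcomp Require Import all_boot all_order all_algebra.
From mathcomp Require Import all_classical all_reals all_analysis.
From mathcomp Require Import ring lra perm fintype finset.
Require Import Defs.

Set Implicit Arguments.
Unset Strict Implicit.
Unset Printing Implicit Defensive.

Import Order.TTheory GRing.Theory Num.Theory.
Import numFieldNormedType.Exports.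

Local Open Scope ring_scope.

(** * Fourier analysis on the cube *)

(** Walsh characters: for a bit [b], [(-1) ^+ b] is the corresponding sign variable. Unlike
    monomials they are orthonormal for the uniform mean. *)
Definition chi (R : realType) (n : nat) (A : {set 'I_n}) (x : cube n) : R :=
  \prod_(i in A) (-1) ^+ (x i : bool).

Definition fourier (R : realType) (n : nat) (h : cube n -> R)
    (A : {set 'I_n}) : R :=
  cube_mean (fun x => h x * chi R A x).

Lemma cube_mean_ext (R : realType) (n : nat) (g h : cube n -> R) :
  g =1 h -> cube_mean g = cube_mean h.
Proof. by move=> gh; rewrite /cube_mean (eq_bigr h). Qed.

Lemma card_cube_gt0 (R : realType) (n : nat) : 0 < #|cube n|%:R :> R.
Proof. by rewrite ltr0n card_ffun card_bool card_ord expn_gt0. Qed.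

Lemma cube_meanD (R : realType) (n : nat) (g h : cube n -> R) :
  cube_mean (fun x => g x + h x) = cube_mean g + cube_mean h.
Proof. by rewrite /cube_mean big_split mulrDl. Qed.

Lemma cube_meanZ (R : realType) (n : nat) (c : R) (g : cube n -> R) :
  cube_mean (fun x => c * g x) = c * cube_mean g.
Proof. by rewrite /cube_mean -mulr_sumr mulrA. Qed.

Lemma cube_meanB (R : realType) (n : nat) (g h : cube n -> R) :
  cube_mean (fun x => g x - h x) = cube_mean g - cube_mean h.
Proof. by rewrite /cube_mean sumrB mulrBl. Qed.

Lemma cube_mean_sum (R : realType) (n : nat) (I : Type) (s : seq I)
    (P : pred I) (g : I -> cube n -> R) :
  cube_mean (fun x => \sum_(i <- s | P i) g i x)
    = \sum_(i <- s | P i) cube_mean (g i).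
Proof. by rewrite /cube_mean exchange_big -mulr_suml. Qed.

Lemma cube_mean_cst (R : realType) (n : nat) (c : R) :
  cube_mean (fun _ : cube n => c) = c.
Proof.
rewrite /cube_mean sumr_const -[c *+ _]mulr_natr mulfK //.
by rewrite gt_eqF // card_cube_gt0.
Qed.

Lemma ler_cube_mean (R : realType) (n : nat) (g h : cube n -> R) :
  (forall x, g x <= h x) -> cube_mean g <= cube_mean h.
Proof.
by move=> gh; rewrite ler_wpM2r ?invr_ge0 ?ler0n // ler_sum.
Qed.

Lemma cube_mean_ge0 (R : realType) (n : nat) (g : cube n -> R) :
  (forall x, 0 <= g x) -> 0 <= cube_mean g.
Proof. by move=> g0; rewrite mulr_ge0 ?invr_ge0 ?ler0n // sumr_ge0. Qed.

Definition symdiff (n : nat) (A B : {set 'I_n}) : {set 'I_n} :=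
  (A :\: B) :|: (B :\: A).

Lemma in_symdiff (n : nat) (A B : {set 'I_n}) i :
  (i \in symdiff A B) = (i \in A) (+) (i \in B).
Proof. by rewrite !inE; case: (i \in A); case: (i \in B). Qed.

Lemma chiE (R : realType) (n : nat) (A : {set 'I_n}) (x : cube n) :
  chi R A x = \prod_i (-1) ^+ ((i \in A) && x i).
Proof.
by rewrite /chi big_mkcond; apply: eq_bigr => i _; case: (i \in A).
Qed.

Lemma chi0 (R : realType) (n : nat) (x : cube n) : chi R set0 x = 1.
Proof. by rewrite /chi big_set0. Qed.

Lemma chiM (R : realType) (n : nat) (A B : {set 'I_n}) (x : cube n) :
  chi R A x * chi R B x = chi R (symdiff A B) x.
Proof.
rewrite !chiE -big_split; apply: eq_bigr => i _; rewrite /= in_symdiff -signr_addb.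
by case: (i \in A); case: (i \in B); case: (x i).
Qed.

Lemma cube_mean_chi (R : realType) (n : nat) (A : {set 'I_n}) :
  cube_mean (chi R A) = (A == set0)%:R.
Proof.
case: eqP => [->|/eqP /set0Pn[i iA]].
  by under cube_mean_ext do rewrite chi0; rewrite cube_mean_cst.
rewrite /cube_mean; under eq_bigr do rewrite chiE.
(* The sum over the cube factors over the coordinates, and the factor at [i] is [-1 + 1]. *)
rewrite -(bigA_distr_bigA (fun i (b : bool) => (-1) ^+ ((i \in A) && b))).
by rewrite (bigD1 i) //= big_bool iA /= expr1 expr0 addNr !mul0r.
Qed.

Lemma symdiff_eq0 (n : nat) (A B : {set 'I_n}) :
  (symdiff A B == set0) = (A == B).
Proof.
apply/eqP/eqP => [AB|->]; apply/setP => i; last first.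
  by rewrite in_symdiff addbb inE.
by move/setP/(_ i): AB; rewrite in_symdiff inE; case: (i \in A); case: (i \in B).
Qed.

Lemma cube_mean_chiM (R : realType) (n : nat) (A B : {set 'I_n}) :
  cube_mean (fun x => chi R A x * chi R B x) = (A == B)%:R.
Proof.
by under cube_mean_ext do rewrite chiM; rewrite cube_mean_chi symdiff_eq0.
Qed.

(** The sum is the expansion of [\prod_i ((-1) ^+ (x i (+) y i) + 1)], where a coordinate on which
    [x] and [y] differ gives a zero factor. Fourier inversion follows. *)
Lemma sum_chiM (R : realType) (n : nat) (x y : cube n) :
  \sum_A chi R A x * chi R A y = (x == y)%:R * #|cube n|%:R.
Proof.
transitivity (\prod_i ((-1) ^+ (x i (+) y i) + 1 : R)).
  rewrite bigA_distr; apply: eq_bigr => A _.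
  rewrite !chiE -big_split; apply: eq_bigr => i _ /=.
  by case: (i \in A) => /=; rewrite ?signr_addb // !expr0 mulr1.
case: eqP => [->|neq].
  under eq_bigr do rewrite addbb expr0.
  by rewrite prodr_const card_ord card_ffun card_bool card_ord natrX mul1r.
have [i xyi] : exists i, x i != y i.
  apply/existsP; apply: contra_notT neq => /existsPn xy.
  by apply/ffunP => i; apply/eqP; have := xy i; rewrite negbK.
rewrite (bigD1 i) //=; case: (x i) (y i) xyi => [] [] //= _;
  by rewrite expr1 addNr !mul0r.
Qed.

Lemma fourierK (R : realType) (n : nat) (h : cube n -> R) (x : cube n) :
  h x = \sum_A fourier h A * chi R A x.
Proof.
rewrite /fourier /cube_mean.
under eq_bigr do rewrite mulrAC mulr_suml.
rewrite -mulr_suml exchange_big /=.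
under eq_bigr => y _ do
  (under eq_bigr do rewrite -mulrA; rewrite -mulr_sumr sum_chiM).
rewrite (bigD1 x) //= big1 => [|y /negbTE ->]; last by rewrite mul0r mulr0.
by rewrite eqxx mul1r addr0 mulfK // gt_eqF // card_cube_gt0.
Qed.

Lemma fourier_chi_sum (R : realType) (n : nat) (P : pred {set 'I_n})
    (c : {set 'I_n} -> R) (B : {set 'I_n}) :
  fourier (fun x => \sum_(A | P A) c A * chi R A x) B = (P B)%:R * c B.
Proof.
rewrite /fourier.
under cube_mean_ext => x.
  rewrite mulr_suml; under eq_bigr do rewrite -mulrA.
  over.
rewrite cube_mean_sum; under eq_bigr do rewrite cube_meanZ cube_mean_chiM.
rewrite big_mkcond (bigD1 B) //= big1 => [|A /negbTE ->]; last first.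
  by rewrite mulr0 if_same.
by rewrite eqxx addr0; case: (P B); rewrite ?mulr1 ?mul1r ?mul0r.
Qed.

(** Stated for a family [P] of sets so that it also applies to the part of a function carried by the
    high sets. *)
Lemma parseval_sum (R : realType) (n : nat) (P : pred {set 'I_n})
    (c : {set 'I_n} -> R) :
  cube_mean (fun x => (\sum_(A | P A) c A * chi R A x) ^+ 2)
    = \sum_(A | P A) c A ^+ 2.
Proof.
under cube_mean_ext => x.
  rewrite expr2 {2}[\sum_(A | P A) _]/= mulr_sumr.
  under eq_bigr do rewrite mulrCA.
  over.
rewrite cube_mean_sum; apply: eq_bigr => B PB.
by rewrite cube_meanZ [X in _ * X]fourier_chi_sum PB mul1r expr2.
Qed.

Lemma parseval (R : realType) (n : nat) (h : cube n -> R) :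
  cube_mean (fun x => h x ^+ 2) = \sum_A fourier h A ^+ 2.
Proof.
rewrite -(parseval_sum predT); apply: cube_mean_ext => x.
by rewrite [h x]fourierK.
Qed.

(** Degree read off the Fourier side, where products and means are easy to control; [fdeg_leP]
    identifies it with [cube_deg]. *)
Definition fdeg_le (R : realType) (n k : nat) (h : cube n -> R) : Prop :=
  forall A : {set 'I_n}, (k < #|A|)%N -> fourier h A = 0.

Lemma fourier_ext (R : realType) (n : nat) (g h : cube n -> R) :
  g =1 h -> fourier g =1 fourier h.
Proof. by move=> gh A; apply: cube_mean_ext => x; rewrite gh. Qed.

Lemma fourierZ (R : realType) (n : nat) (c : R) (h : cube n -> R) A :
  fourier (fun x => c * h x) A = c * fourier h A.
Proof. by rewrite -cube_meanZ; apply: cube_mean_ext => x; rewrite mulrA. Qed.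

Lemma fourier_sum (R : realType) (n : nat) (I : Type) (s : seq I)
    (P : pred I) (g : I -> cube n -> R) A :
  fourier (fun x => \sum_(i <- s | P i) g i x) A
    = \sum_(i <- s | P i) fourier (g i) A.
Proof.
by rewrite -cube_mean_sum; apply: cube_mean_ext => x; rewrite mulr_suml.
Qed.

Lemma fdeg_le_ext (R : realType) (n k : nat) (g h : cube n -> R) :
  g =1 h -> fdeg_le k g -> fdeg_le k h.
Proof. by move=> gh gk A kA; rewrite -(fourier_ext gh) gk. Qed.

Lemma fdeg_leW (R : realType) (n k l : nat) (h : cube n -> R) :
  (k <= l)%N -> fdeg_le k h -> fdeg_le l h.
Proof. by move=> kl hk A lA; apply: hk; apply: leq_ltn_trans lA. Qed.

Lemma fdeg_le_sum (R : realType) (n k : nat) (I : Type) (s : seq I)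
    (P : pred I) (g : I -> cube n -> R) :
  (forall i, P i -> fdeg_le k (g i)) ->
  fdeg_le k (fun x => \sum_(i <- s | P i) g i x).
Proof. by move=> gk A kA; rewrite fourier_sum big1 // => i /gk ->. Qed.

Lemma fdeg_leZ (R : realType) (n k : nat) (c : R) (h : cube n -> R) :
  fdeg_le k h -> fdeg_le k (fun x => c * h x).
Proof. by move=> hk A kA; rewrite fourierZ hk // mulr0. Qed.

Lemma fdeg_leD (R : realType) (n k : nat) (g h : cube n -> R) :
  fdeg_le k g -> fdeg_le k h -> fdeg_le k (fun x => g x + h x).
Proof.
move=> gk hk A kA; rewrite -[RHS](addr0 0) -{1}(gk A kA) -(hk A kA) -cube_meanD.
by apply: cube_mean_ext => x; rewrite mulrDl.
Qed.

Lemma card_symdiff (n : nat) (A B : {set 'I_n}) :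
  (#|symdiff A B| <= #|A| + #|B|)%N.
Proof.
apply: leq_trans (leq_card_setU _ _) _.
by rewrite leq_add // subset_leq_card // subsetDl.
Qed.

(** A product of characters is the character of the symmetric difference, whose size is at most the
    sum of the sizes. *)
Lemma fdeg_leM (R : realType) (n k l : nat) (g h : cube n -> R) :
  fdeg_le k g -> fdeg_le l h -> fdeg_le (k + l) (fun x => g x * h x).
Proof.
move=> gk hl A klA; rewrite [LHS]/fourier.
have E B C x : fourier g B * chi R B x * (fourier h C * chi R C x) * chi R A x
    = fourier g B * fourier h C * chi R (symdiff (symdiff B C) A) x.
  by rewrite -!chiM; ring.
under cube_mean_ext => x.
  rewrite [g x]fourierK [h x]fourierK mulr_suml mulr_suml.
  under eq_bigr => B _.
    rewrite mulr_sumr mulr_suml.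
    under eq_bigr => C _ do rewrite E.
    over.
  over.
rewrite cube_mean_sum big1 // => B _; rewrite cube_mean_sum big1 // => C _.
rewrite cube_meanZ cube_mean_chi symdiff_eq0.
have [kB|Bk] := ltnP k #|B|; first by rewrite gk // !mul0r.
have [lC|Cl] := ltnP l #|C|; first by rewrite hl // mulr0 mul0r.
case: eqP => [BCA|_]; last by rewrite mulr0.
move: klA; rewrite -BCA ltnNge (leq_trans (card_symdiff B C)) //.
by rewrite leq_add.
Qed.

Lemma fdeg_le_cst (R : realType) (n k : nat) (c : R) :
  fdeg_le k (fun _ : cube n => c).
Proof.
move=> A kA; rewrite /fourier cube_meanZ cube_mean_chi.
by rewrite -cards_eq0 gtn_eqF ?mulr0 //; apply: leq_trans kA.
Qed.

Lemma fdeg_le_chi (R : realType) (n : nat) (A : {set 'I_n}) :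
  fdeg_le #|A| (chi R A).
Proof.
move=> B AB; rewrite /fourier cube_mean_chiM; case: eqP => // eqAB.
by rewrite eqAB ltnn in AB.
Qed.

Definition flip (n : nat) (i : 'I_n) (x : cube n) : cube n :=
  [ffun j => (j == i) (+) x j].

Lemma flipK (n : nat) (i : 'I_n) : involutive (flip i).
Proof. by move=> x; apply/ffunP => j; rewrite !ffunE addKb. Qed.

Lemma cube_mean_flip (R : realType) (n : nat) (i : 'I_n) (h : cube n -> R) :
  cube_mean (fun x => h (flip i x)) = cube_mean h.
Proof.
rewrite /cube_mean; congr (_ / _); apply/esym.
by rewrite (reindex_inj (inv_inj (@flipK n i))).
Qed.

Lemma chi_flip (R : realType) (n : nat) (i : 'I_n) (A : {set 'I_n}) x :
  chi R A (flip i x) = (-1) ^+ (i \in A) * chi R A x.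
Proof.
rewrite !chiE; case: (boolP (i \in A)) => iA; rewrite ?mul1r; last first.
  apply: eq_bigr => j _; rewrite ffunE; case: eqP => // ->.
  by rewrite (negbTE iA).
rewrite (bigD1 i) //= [in RHS](bigD1 i) //= iA !ffunE eqxx mulrA.
congr (_ * _).
  by case: (x i); rewrite /= ?expr0 ?expr1 ?mulr1 ?mulN1r ?opprK.
by apply: eq_bigr => j /negbTE nji; rewrite ffunE nji.
Qed.

(** Flipping bit [i] preserves the mean and [h] but changes the sign of [chi R A], so the
    coefficient equals its opposite. *)
Lemma fourier_flip (R : realType) (n : nat) (i : 'I_n) (h : cube n -> R)
    (A : {set 'I_n}) :
  (forall x, h (flip i x) = h x) -> i \in A -> fourier h A = 0.
Proof.
move=> hi iA; have : fourier h A = - fourier h A.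
  rewrite -mulN1r /fourier -cube_meanZ -(cube_mean_flip i).
  by apply: cube_mean_ext => x; rewrite hi chi_flip iA expr1 mulrCA.
by move/eqP; rewrite -addr_eq0 -mulr2n mulrn_eq0 /= => /eqP.
Qed.

Lemma fdeg_le_junta (R : realType) (n : nat) (S : {set 'I_n})
    (h : cube n -> R) :
  (forall i x, i \notin S -> h (flip i x) = h x) -> fdeg_le #|S| h.
Proof.
move=> hS A SA.
have /subsetPn[i iA iS] : ~~ (A \subset S).
  by apply: contraL SA => /subset_leq_card; rewrite -leqNgt.
by apply: (fourier_flip (i := i)) => // x; apply: hS.
Qed.

(** * Restriction to a random set of coordinates *)

Lemma cube_deg_leP (R : realType) (n k : nat) (h : cube n -> R) :
  (cube_deg h <= k)%N <-> (forall A : {set 'I_n}, (k < #|A|)%N -> ml_coef h A = 0).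
Proof.
split=> [/bigmax_leqP hk A kA|hk].
  by apply: contraTeq kA => /hk; rewrite -leqNgt.
by apply/bigmax_leqP => A; apply: contraNT; rewrite -ltnNge => /hk ->.
Qed.

(** Since [(-1) ^+ b = 1 - 2 b] for a bit [b], expanding the product over [A] displays a multilinear
    form, and uniqueness of that form gives the coefficients. *)
Lemma ml_coef_chi (R : realType) (n : nat) (A B : {set 'I_n}) :
  ml_coef (chi R A) B = (B \subset A)%:R * (-2) ^+ #|B|.
Proof.
rewrite -(ml_coef_uniq (c := fun B => (B \subset A)%:R * (-2) ^+ #|B|)) //.
move=> x; rewrite /ml_eval chiE.
transitivity (\prod_i ((i \in A)%:R * (-2) * (x i)%:R + 1 : R)).
  rewrite bigA_distr; apply: eq_bigr => {}B _.
  rewrite -big_mkcond /= !big_split /= prodr_const; congr (_ * _ * _).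
  case: (boolP (B \subset A)) => [/subsetP BA|/subsetPn[i iB iA]].
    by rewrite big1 // => i /BA ->.
  by rewrite (bigD1 i) //= (negbTE iA) mul0r.
apply: eq_bigr => i _.
by case: (i \in A); case: (x i); rewrite /= ?expr0 ?expr1; ring.
Qed.

Lemma ml_coef_sum (R : realType) (n : nat) (I : Type) (s : seq I)
    (P : pred I) (c : I -> R) (g : I -> cube n -> R)
    (A : {set 'I_n}) :
  ml_coef (fun x => \sum_(i <- s | P i) c i * g i x) A
    = \sum_(i <- s | P i) c i * ml_coef (g i) A.
Proof.
rewrite /ml_coef; under eq_bigr do rewrite mulr_sumr.
rewrite exchange_big; apply: eq_bigr => i _; rewrite mulr_sumr.
by apply: eq_bigr => B _; rewrite mulrCA.
Qed.

Lemma eq_ml_coef (R : realType) (n : nat) (g h : cube n -> R) :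
  g =1 h -> ml_coef g =1 ml_coef h.
Proof. by move=> gh A; apply: eq_bigr => B _; rewrite gh. Qed.

(** The change of basis respects inclusion both ways: a monomial on [A] depends only on the bits in
    [A], and a character on [B] expands into monomials on subsets of [B]. *)
Lemma fdeg_leP (R : realType) (n k : nat) (h : cube n -> R) :
  (cube_deg h <= k)%N <-> fdeg_le k h.
Proof.
rewrite cube_deg_leP; split=> hk.
  apply: (fdeg_le_ext (ml_coefK h)); apply: fdeg_le_sum => A _.
  have [kA|Ak] := ltnP k #|A|.
    rewrite hk //; apply: (@fdeg_le_ext _ _ _ (fun=> 0)) => [x|].
      by rewrite mul0r.
    exact: fdeg_le_cst.
  apply: fdeg_leZ; apply: (fdeg_leW Ak); apply: fdeg_le_junta => i x iA.
  apply: eq_bigr => j jA; rewrite ffunE.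
  by case: eqP => // eqji; rewrite eqji (negbTE iA) in jA.
move=> A kA; rewrite (eq_ml_coef (fourierK h)) ml_coef_sum big1 // => B _.
have [kB|Bk] := ltnP k #|B|; first by rewrite hk ?mul0r.
have /negbTE AB : ~~ (A \subset B).
  by apply: contraL kA => /subset_leq_card AB; rewrite -leqNgt (leq_trans AB).
by rewrite ml_coef_chi AB mul0r mulr0.
Qed.

(** * Separating the bits inside and outside a set of coordinates *)

(** A full point [z] supplies the bits outside [S]; its bits in [S] are overwritten by [y]. This
    avoids a separate type of points on the complement. *)
Definition merge (n m : nat) (S : msubset n m) (z : cube n) (y : cube m) :
    cube n :=
  [ffun i => if [pick j | msubset_nth S j == i] is Some j then y j else z i].

Lemma msubset_nth_inj (n m : nat) (S : msubset n m) : injective (msubset_nth S).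
Proof. by move=> i j /enum_val_inj /cast_ord_inj. Qed.

Lemma msubset_nth_surj (n m : nat) (S : msubset n m) (i : 'I_n) :
  i \in val S -> exists j, msubset_nth S j = i.
Proof.
move=> iS; exists (cast_ord (eqP (valP S)) (enum_rank_in iS i)).
by rewrite /msubset_nth cast_ordK enum_rankK_in.
Qed.

Lemma merge_nth (n m : nat) (S : msubset n m) (z : cube n) (y : cube m)
    (j : 'I_m) :
  merge S z y (msubset_nth S j) = y j.
Proof.
rewrite ffunE; case: pickP => [j' /eqP /msubset_nth_inj -> //|/(_ j)].
by rewrite eqxx.
Qed.

Lemma merge_notin (n m : nat) (S : msubset n m) (z : cube n) (y : cube m)
    (i : 'I_n) :
  i \notin val S -> merge S z y i = z i.
Proof.
move=> iS; rewrite ffunE; case: pickP => // j /eqP eqji.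
by rewrite -eqji msubset_nth_in in iS.
Qed.

Lemma restrict_merge (n m : nat) (S : msubset n m) (z : cube n) (y : cube m) :
  restrict S (merge S z y) = y.
Proof. by apply/ffunP => j; rewrite ffunE merge_nth. Qed.

Lemma merge_restrict (n m : nat) (S : msubset n m) (z : cube n) (y : cube m) :
  merge S (merge S z y) (restrict S z) = z.
Proof.
apply/ffunP => i; case: (boolP (i \in val S)) => iS; last first.
  by rewrite !merge_notin.
by have [j <-] := msubset_nth_surj iS; rewrite merge_nth ffunE.
Qed.

(** Exchanging [y] with the bits of [z] in [S] is an involution on pairs, so merging uniform [z] and
    [y] gives a uniform point. *)
Lemma cube_mean_merge (R : realType) (n m : nat) (S : msubset n m)
    (h : cube n -> R) :
  cube_mean h = cube_mean (fun z => cube_mean (fun y => h (merge S z y))).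
Proof.
pose phi (p : cube n * cube m) : cube n * cube m :=
  (merge S p.1 p.2, restrict S p.1).
have phiK : involutive phi.
  by move=> [z y]; rewrite /phi /= merge_restrict restrict_merge.
have -> : cube_mean (fun z => cube_mean (fun y => h (merge S z y)))
    = (\sum_p h (phi p).1) / (#|cube n|%:R * #|cube m|%:R).
  rewrite invfM /cube_mean -mulr_suml pair_big /= mulrA mulrAC.
  by under [in RHS]eq_bigr do rewrite /phi /=.
have -> : \sum_p h (phi p).1 = \sum_(p : cube n * cube m) h p.1.
  by rewrite [RHS](reindex_inj (inv_inj phiK)).
rewrite -(pair_big xpredT xpredT (fun z _ => h z)) /=.
under eq_bigr do rewrite sumr_const -[_ *+ _]mulr_natr.
rewrite -mulr_suml /cube_mean -mulf_div divff ?mulr1 //.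
by rewrite gt_eqF // card_cube_gt0.
Qed.

Lemma chi_merge (R : realType) (n m : nat) (S : msubset n m)
    (A : {set 'I_n}) (z : cube n) (y : cube m) :
  chi R A (merge S z y) = chi R (A :\: val S) z
    * chi R [set j | msubset_nth S j \in A] y.
Proof.
rewrite /chi (bigID (mem (val S))) /= mulrC; congr (_ * _).
  apply: eq_big => i; first by rewrite !inE andbC.
  by case/andP => _ iS; rewrite merge_notin.
rewrite (eq_bigl (mem (msubset_nth S @: [set j | msubset_nth S j \in A]))).
  rewrite big_imset /=; last by move=> j k _ _; apply: msubset_nth_inj.
  by apply: eq_bigr => j _; rewrite merge_nth.
move=> i; apply/andP/imsetP => [[iA iS]|[j jA ->]].
  by have [j eqji] := msubset_nth_surj iS; exists j; rewrite ?inE eqji.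
by rewrite inE in jA; rewrite jA msubset_nth_in.
Qed.

(* Conditioning on the bits outside S, a function whose Fourier support meets
   S in at most d/2 elements is a polynomial of degree at most d/2 in x_S. *)
Lemma pseudo_density_low (R : realType) (n m d : nat) (D : cube m -> R)
    (S : msubset n m) (h : cube n -> R) :
  pseudo_density d D ->
  (forall A : {set 'I_n}, (d < 2 * #|A :&: val S|)%N -> fourier h A = 0) ->
  0 <= cube_mean (fun x => D (restrict S x) * h x ^+ 2).
Proof.
move=> [_ Dpos] hS; rewrite (cube_mean_merge S); apply: cube_mean_ge0 => z.
under cube_mean_ext do rewrite restrict_merge.
apply: Dpos; rewrite mul2n -geq_half_double; apply/fdeg_leP.
apply: (@fdeg_le_ext _ _ _ (fun y => \sum_A fourier h A
    * chi R (A :\: val S) z * chi R [set j | msubset_nth S j \in A] y)).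
  move=> y; rewrite [RHS]fourierK; apply: eq_bigr => A _.
  by rewrite -mulrA -chi_merge.
apply: fdeg_le_sum => A _.
have [dA|Ad] := ltnP d (2 * #|A :&: val S|); last first.
  apply: fdeg_leZ; apply: (fdeg_leW _ (@fdeg_le_chi _ _ _)).
  rewrite geq_half_double -mul2n (leq_trans _ Ad) // leq_mul2l /=.
  rewrite -(card_imset _ (@msubset_nth_inj _ _ S)) subset_leq_card //.
  apply/subsetP => _ /imsetP[j jA ->].
  by rewrite inE in jA; rewrite inE jA msubset_nth_in.
apply: (@fdeg_le_ext _ _ _ (fun=> 0)) => [y|]; last exact: fdeg_le_cst.
by rewrite hS // !mul0r.
Qed.

(** Split [h = l + g] according to whether a set meets [S] in at most [d / 2] points. The low part
    [l] contributes nonnegatively, and the error [h ^+ 2 - l ^+ 2 = 2 h g - g ^+ 2] is absorbed by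
    AM-GM with weight [tau]. *)
Lemma pseudo_density_lower (R : realType) (n m d : nat) (D : cube m -> R)
    (N tau : R) (S : msubset n m) (h : cube n -> R) :
  pseudo_density d D -> (forall y, `|D y| <= N) -> 0 < tau <= 1 ->
  - (N * (tau * cube_mean (fun x => h x ^+ 2) + 2 / tau *
      \sum_(A : {set 'I_n} | (d < 2 * #|A :&: val S|)%N) fourier h A ^+ 2))
    <= cube_mean (fun x => D (restrict S x) * h x ^+ 2).
Proof.
move=> Dd DN /andP[tau0 tau1].
pose hi A := (d < 2 * #|A :&: val S|)%N.
pose l x := \sum_(A | ~~ hi A) fourier h A * chi R A x.
pose g x := \sum_(A | hi A) fourier h A * chi R A x.
have hE x : h x = l x + g x by rewrite [LHS]fourierK (bigID hi) addrC.
have low : 0 <= cube_mean (fun x => D (restrict S x) * l x ^+ 2).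
  apply: pseudo_density_low Dd _ => A hiA.
  by rewrite fourier_chi_sum /hi hiA mul0r.
apply: (@le_trans _ _ (cube_mean (fun x =>
    D (restrict S x) * h x ^+ 2 - D (restrict S x) * l x ^+ 2))); last first.
  by rewrite cube_meanB gerBl.
rewrite -(parseval_sum hi) -2!cube_meanZ -cube_meanD -cube_meanZ -mulN1r.
rewrite -cube_meanZ; apply: ler_cube_mean => x.
rewrite mulN1r -mulrBr -/(g x) lerNl -mulrN.
have -> : - (h x ^+ 2 - l x ^+ 2) = g x ^+ 2 - 2 * h x * g x by rewrite hE; ring.
apply: le_trans (ler_norm _) _; rewrite normrM.
apply: le_trans (ler_wpM2r (normr_ge0 _) (DN _)) _.
have N0 : 0 <= N by apply: le_trans (normr_ge0 (D (restrict S x))) (DN _).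
rewrite ler_wpM2l // -[2 / tau]/(2 * tau^-1).
move: (h x) (g x) => a b.
(* As [tau <= 1], the stray [b ^+ 2] is at most [b ^+ 2 / tau], whence the constant 2. *)
have tauV : 1 <= tau^-1 by rewrite invf_ge1.
have b2 : b ^+ 2 <= b ^+ 2 / tau by rewrite ler_peMr // sqr_ge0.
have pos : 0 <= b ^+ 2 by rewrite sqr_ge0.
have am1 : 0 <= tau * (a + b / tau) ^+ 2 by rewrite mulr_ge0 ?sqr_ge0 // ltW.
have am2 : 0 <= tau * (a - b / tau) ^+ 2 by rewrite mulr_ge0 ?sqr_ge0 // ltW.
have e1 : tau * (a + b / tau) ^+ 2
    = tau * a ^+ 2 + 2 * a * b + b ^+ 2 / tau by field; rewrite gt_eqF.
have e2 : tau * (a - b / tau) ^+ 2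
    = tau * a ^+ 2 - 2 * a * b + b ^+ 2 / tau by field; rewrite gt_eqF.
have -> : 2 / tau * b ^+ 2 = 2 * (b ^+ 2 / tau) by ring.
by rewrite ler_norml; apply/andP; split; lra.
Qed.

(** * Counting the [m]-sets that meet a given set in many points *)

(** A uniform [m]-set contains a fixed [t]-set with probability at most [(m / n) ^ t]; the induction
    step uses [(m - t) / (n - t) <= m / n]. *)
Lemma bin_superset_le (n m t : nat) : (t <= m <= n)%N ->
  ('C(n - t, m - t) * n ^ t <= 'C(n, m) * m ^ t)%N.
Proof.
elim: t => [|t IH] /andP[tm mn]; first by rewrite !subn0.
have nt0 : (0 < n - t)%N by rewrite subn_gt0 (leq_trans tm).
rewrite -(leq_pmul2l nt0).
have -> : ((n - t) * ('C(n - t.+1, m - t.+1) * n ^ t.+1)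
    = ((n - t) * 'C((n - t).-1, m - t.+1)) * n ^ t.+1)%N by rewrite mulnA subnS.
rewrite mul_bin_diag -subSn // subSS expnS.
have := IH; rewrite (ltnW tm) mn => /(_ isT) {}IH.
have -> : ((m - t) * 'C(n - t, m - t) * (n * n ^ t)
    = (m - t) * n * ('C(n - t, m - t) * n ^ t))%N by ring.
apply: leq_trans (leq_mul (leqnn _) IH) _.
have -> : ((m - t) * n * ('C(n, m) * m ^ t)
    = ('C(n, m) * m ^ t) * ((m - t) * n))%N by ring.
have -> : ((n - t) * ('C(n, m) * m ^ t.+1)
    = ('C(n, m) * m ^ t) * ((n - t) * m))%N by rewrite expnS; ring.
by rewrite leq_mul2l !mulnBl (mulnC n m) leq_sub2l ?orbT // leq_mul2l mn orbT.
Qed.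

Lemma card_msubset (n m : nat) : #|msubset n m| = 'C(n, m).
Proof.
rewrite card_sig -[in RHS](card_ord n) -card_draws.
by apply: eq_card => S; rewrite !inE.
Qed.

Lemma card_msubset_sub (n m : nat) (P : pred {set 'I_n}) :
  #|[set S : msubset n m | P (val S)]|
    = #|[set S : {set 'I_n} | (#|S| == m) && P S]|.
Proof.
rewrite -(card_imset _ val_inj); apply: eq_card => S; rewrite !inE.
apply/imsetP/andP => [[S' PS' ->]|[Sm PS]].
  by rewrite inE in PS'; rewrite PS' (valP S').
by exists (exist _ S Sm) => //; rewrite inE.
Qed.

Lemma card_superset_le (n m : nat) (T : {set 'I_n}) : (m <= n)%N ->
  (#|[set S : msubset n m | T \subset val S]| * n ^ #|T|
    <= 'C(n, m) * m ^ #|T|)%N.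
Proof.
move=> mn; rewrite (card_msubset_sub m (fun S => T \subset S)).
have [Tm|mT] := leqP #|T| m; last first.
  rewrite (_ : [set _ | _] = set0) ?cards0 //.
  apply/setP => S; rewrite !inE; apply/negbTE; rewrite negb_and.
  have [/eqP Sm|//] := boolP (#|S| == m); rewrite /=.
  by apply: contraL mT => /subset_leq_card; rewrite Sm -leqNgt.
apply: leq_trans (bin_superset_le (t := #|T|) _); last by rewrite Tm.
have -> : (n - #|T|)%N = #|~: T| by rewrite [RHS]cardsCs setCK card_ord.
rewrite -cards_draws leq_mul2r; apply/orP; right.
rewrite -(card_in_imset (f := fun S => S :\: T)); last first.
  move=> S S'; rewrite !inE => /andP[_ TS] /andP[_ TS'] SS'.
  by rewrite -(setID S T) -(setID S' T) SS' (setIidPr TS) (setIidPr TS').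
apply/subset_leq_card/subsetP => _ /imsetP[S + ->].
rewrite !inE => /andP[/eqP Sm TS]; rewrite cardsD (setIidPr TS) Sm eqxx andbT.
by rewrite setDE subsetIr.
Qed.

Lemma bin_le_exp (a s : nat) : ('C(a, s) <= a ^ s)%N.
Proof.
apply: (@leq_trans (a ^_ s)).
  by rewrite -bin_ffact leq_pmulr // fact_gt0.
elim: s => [|s IH]; first by rewrite ffactn0.
by rewrite ffactnSr expnSr leq_mul // leq_subr.
Qed.

Lemma leq_card_bigcup (I T : finType) (P : pred I) (F : I -> {set T}) :
  (#|\bigcup_(i | P i) F i| <= \sum_(i | P i) #|F i|)%N.
Proof.
elim/big_rec2: _ => [|i k S _ IH]; first by rewrite cards0.
by apply: leq_trans (leq_card_setU _ _) _; rewrite leq_add2l.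
Qed.

(* Union bound over the s-subsets T of A, each contained in S with probability
   at most (m/n)^s. *)
Lemma card_intersect_ge (n m s K : nat) (A : {set 'I_n}) :
  (m <= n)%N -> (#|A| <= K)%N ->
  (#|[set S : msubset n m | (s <= #|A :&: val S|)%N]| * n ^ s
    <= 'C(n, m) * (K * m) ^ s)%N.
Proof.
move=> mn AK; pose Ts := [set T : {set 'I_n} | T \subset A & #|T| == s].
have sub : [set S : msubset n m | (s <= #|A :&: val S|)%N]
    \subset \bigcup_(T in Ts) [set S : msubset n m | T \subset val S].
  apply/subsetP => S; rewrite inE -bin_gt0 -cards_draws => /card_gt0P[T].
  rewrite inE subsetI => /andP[/andP[TA TS] Ts'].
  by apply/bigcupP; exists T; rewrite inE ?TA.
apply: leq_trans (leq_mul (subset_leq_card sub) (leqnn _)) _.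
apply: (@leq_trans (\sum_(T in Ts) 'C(n, m) * m ^ s)%N).
  apply: leq_trans (leq_mul (leq_card_bigcup _ _) (leqnn _)) _.
  rewrite big_distrl leq_sum // => T; rewrite inE => /andP[_ /eqP <-].
  exact: card_superset_le.
rewrite sum_nat_const cards_draws expnMn mulnCA leq_mul2l; apply/orP; right.
rewrite leq_mul2r; apply/orP; right.
apply: leq_trans (bin_le_exp _ _) _; case: (s) => // t.
by rewrite leq_exp2r.
Qed.

(* For uniform S, P[d < 2|A ∩ S|] <= (Km/n)^(⌊d/2⌋+1) whenever |A| <= K. *)
Lemma sum_high_le (R : realType) (n m d K : nat) (c : {set 'I_n} -> R) :
  (0 < n)%N -> (m <= n)%N -> (forall A, 0 <= c A) ->
  (forall A : {set 'I_n}, (K < #|A|)%N -> c A = 0) ->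
  \sum_(S : msubset n m)
      \sum_(A : {set 'I_n} | (d < 2 * #|A :&: val S|)%N) c A
    <= #|msubset n m|%:R * (((K * m)%:R / n%:R) ^+ (d./2).+1 * \sum_A c A).
Proof.
move=> n0 mn c0 cK; rewrite (exchange_big_dep xpredT) //= mulrA mulr_sumr.
apply: ler_sum => A _; have [KA|AK] := ltnP K #|A|.
  by rewrite big1 ?cK ?mulr0 // => S _; rewrite cK.
rewrite sumr_const -[c A *+ _]mulr_natl ler_wpM2r //.
rewrite expr_div_n mulrA ler_pdivlMr ?exprn_gt0 ?ltr0n //.
rewrite -!natrX -!natrM ler_nat card_msubset.
apply: leq_trans (card_intersect_ge _ mn AK); rewrite leq_mul2r.
apply/orP; right; rewrite -cardsE; apply/subset_leq_card/subsetP => S.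
(* [d < 2 a] amounts to [(d./2).+1 <= a], also for odd [d]. *)
by rewrite !inE ltn_half_double -mul2n.
Qed.

(** * Positive semidefinite matrices *)

Definition bform (R : realType) (r : nat) (A : 'M[R]_r) (u v : 'rV[R]_r) : R :=
  (u *m A *m v^T) 0 0.

Lemma bformC (R : realType) (r : nat) (A : 'M[R]_r) (u v : 'rV[R]_r) :
  A^T = A -> bform A u v = bform A v u.
Proof.
move=> AT; rewrite /bform -[u *m A *m v^T]trmxK mxE !trmx_mul trmxK AT.
by rewrite mulmxA.
Qed.

Lemma bformDl (R : realType) (r : nat) (A : 'M[R]_r) (u v w : 'rV[R]_r) (t : R) :
  bform A (u + t *: v) w = bform A u w + t * bform A v w.
Proof. by rewrite /bform !mulmxDl -!scalemxAl !mxE. Qed.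

Lemma bformDr (R : realType) (r : nat) (A : 'M[R]_r) (u v w : 'rV[R]_r) (t : R) :
  bform A w (u + t *: v) = bform A w u + t * bform A w v.
Proof.
by rewrite /bform [(u + _)^T]raddfD /= [(t *: v)^T]linearZ /= mulmxDr
  -scalemxAr !mxE.
Qed.

(** Evaluate at the minimiser [- b / c]; when [c = 0], nonnegativity of an affine function forces
    [b = 0]. *)
Lemma discriminant_le0 (R : realType) (a b c : R) : 0 <= c ->
  (forall t, 0 <= a + 2 * b * t + c * t ^+ 2) -> b ^+ 2 <= a * c.
Proof.
rewrite le_eqVlt => /orP[/eqP <-|c0] pos.
  have [->|b0] := eqVneq b 0; first by rewrite expr0n mulr0.
  have := pos (- (a + 1) / (2 * b)); rewrite mul0r addr0.
  by rewrite [2 * b * _]mulrC divfK ?mulf_neq0 // => ?; exfalso; lra.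
have := pos (- b / c).
have -> : a + 2 * b * (- b / c) + c * (- b / c) ^+ 2 = (a * c - b ^+ 2) / c.
  by field; rewrite gt_eqF.
by rewrite ler_pdivlMr // mul0r subr_ge0.
Qed.

Lemma psdmx_cauchy (R : realType) (r : nat) (A : 'M[R]_r) (u v : 'rV[R]_r) :
  psdmx A -> bform A u v ^+ 2 <= bform A u u * bform A v v.
Proof.
move=> [AT A0]; apply: discriminant_le0 => [|t]; first exact: A0.
have := A0 (u + t *: v); rewrite -/(bform _ _ _) bformDl !bformDr (bformC v u AT).
by move=> h; apply: le_trans h _; rewrite le_eqVlt; apply/orP; left; apply/eqP; ring.
Qed.

Lemma psdmx_conj (R : realType) (r q : nat) (A : 'M[R]_r) (P : 'M[R]_(r, q)) :
  psdmx A -> psdmx (P^T *m A *m P).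
Proof.
move=> [AT A0]; split=> [|v]; first by rewrite !trmx_mul trmxK AT mulmxA.
by have := A0 (v *m P^T); rewrite trmx_mul trmxK !mulmxA.
Qed.

Lemma psdmxD (R : realType) (r : nat) (A B : 'M[R]_r) :
  psdmx A -> psdmx B -> psdmx (A + B).
Proof.
move=> [AT A0] [BT B0]; split=> [|v]; first by rewrite raddfD /= AT BT.
by rewrite mulmxDr mulmxDl mxE addr_ge0.
Qed.

Lemma psdmxZ (R : realType) (r : nat) (c : R) (A : 'M[R]_r) :
  0 <= c -> psdmx A -> psdmx (c *: A).
Proof.
move=> c0 [AT A0]; split=> [|v]; first by rewrite linearZ /= AT.
by rewrite -scalemxAr -scalemxAl mxE mulr_ge0.
Qed.

Lemma psdmx_gram (R : realType) (r q : nat) (V : 'M[R]_(q, r)) :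
  psdmx (V^T *m V).
Proof.
split=> [|v]; first by rewrite trmx_mul trmxK.
rewrite mulmxA -mulmxA -{2}[V]trmxK -trmx_mul mxE sumr_ge0 // => i _.
by rewrite [X in _ * X]mxE -expr2 sqr_ge0.
Qed.

Lemma psdmx1 (R : realType) (r : nat) : psdmx (1%:M : 'M[R]_r).
Proof. by have := @psdmx_gram R r r 1%:M; rewrite trmx1 mulmx1. Qed.

Lemma psdmx0 (R : realType) (r : nat) : psdmx (0 : 'M[R]_r).
Proof. by have := @psdmx_gram R r r 0; rewrite mulmx0. Qed.

Lemma psdmx_sum (R : realType) (r : nat) (I : Type) (s : seq I) (P : pred I)
    (A : I -> 'M[R]_r) :
  (forall i, P i -> psdmx (A i)) -> psdmx (\sum_(i <- s | P i) A i).
Proof.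
by move=> Ap; elim/big_rec: _ => [|i B Pi]; [exact: psdmx0|apply/psdmxD/Ap].
Qed.

(** Cholesky factorization, by induction on the size: split off the first row and column and pass to
    the Schur complement. *)
Lemma psdmx_gramP (R : realType) (r : nat) (A : 'M[R]_r) :
  psdmx A -> exists V : 'M[R]_r, A = V^T *m V.
Proof.
elim: r A => [|r IH] A [AT A0].
  by exists 0; apply/matrixP => -[].
rewrite -[r.+1]/(1 + r)%N in A AT A0 *.
pose a := A 0 0; pose b := ursubmx A; pose D := drsubmx A.
have AE : A = block_mx a%:M b b^T D.
  by rewrite -[LHS]submxK trmx_ursub AT (mx11_scalar (ulsubmx A)) !mxE !lshift0.
have q (s : R) (v : 'rV[R]_r) : 0 <= a * s ^+ 2 + 2 * (b *m v^T) 0 0 * s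
    + (v *m D *m v^T) 0 0.
  have := A0 (row_mx s%:M v); rewrite AE mul_row_block tr_row_mx mul_row_col.
  rewrite !mulmxDl tr_scalar_mx !mul_scalar_mx !mul_mx_scalar -!scalemxAl.
  have -> : v *m b^T = (b *m v^T)^T by rewrite trmx_mul trmxK.
  rewrite scale_scalar_mx (mx11_scalar (b *m v^T)) !mxE eqxx !mulr1n.
  move: ((b *m v^T) 0 0) ((v *m D *m v^T) 0 0) => x y h.
  apply: le_trans h _; rewrite le_eqVlt; apply/orP; left; apply/eqP; ring.
have a0 : 0 <= a.
  by have := q 1 0; rewrite trmx0 !mulmx0 mxE !(expr1n, mulr1, mulr0, mul0r, addr0).
have cs (v : 'rV[R]_r) : (b *m v^T) 0 0 ^+ 2 <= (v *m D *m v^T) 0 0 * a.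
  apply: discriminant_le0 => // t; by have := q t v; lra.
(* The Schur complement of the pivot [a]. For a zero pivot [a^-1] is 0 by convention, and this is
   just [D]. *)
have psdD : psdmx (D - a^-1 *: (b^T *m b)).
  split=> [|v].
    rewrite raddfB /= [(a^-1 *: _)^T]linearZ /= trmx_mul trmxK.
    by rewrite trmx_drsub AT.
  rewrite mulmxBr mulmxBl -scalemxAr -scalemxAl.
  have -> : v *m (b^T *m b) *m v^T = (b *m v^T)^T *m (b *m v^T).
    by rewrite trmx_mul trmxK !mulmxA.
  have E (M y : 'M[R]_1) :
      (M - a^-1 *: (y^T *m y)) 0 0 = M 0 0 - a^-1 * y 0 0 ^+ 2.
    by rewrite !mxE big_ord1 !mxE expr2.
  rewrite E subr_ge0.
  have [a00|an0] := eqVneq a 0.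
    rewrite a00 invr0 mul0r; have := q 0 v.
    by rewrite expr0n !mulr0 !add0r.
  by rewrite mulrC ler_pdivrMr // lt_def an0.
have [V VE] := IH _ psdD.
exists (block_mx (Num.sqrt a)%:M ((Num.sqrt a)^-1 *: b) 0 V).
rewrite tr_block_mx mulmx_block trmx0 !mul0mx !mulmx0 !addr0 -VE AE.
rewrite tr_scalar_mx -scalar_mxM -expr2 sqr_sqrtr // mul_scalar_mx scalerA.
rewrite mul_mx_scalar [(_ *: b)^T]linearZ /= !scalerA -scalemxAl -scalemxAr.
rewrite scalerA -invfM -expr2 sqr_sqrtr // addrC subrK.
(* With a zero pivot, [cs] forces [b = 0], so the factor remains correct. *)
have [a00|an0] := eqVneq a 0; last first.
  by rewrite divff ?scale1r // sqrtr_eq0 -ltNge lt_def an0.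
have -> : b = 0; last by rewrite trmx0 !scaler0.
apply/matrixP => i j; rewrite ord1 [RHS]mxE.
have := cs (delta_mx 0 j); rewrite a00 mulr0 trmx_delta -colE !mxE => h.
by apply/eqP; rewrite -sqrf_eq0 eq_le h sqr_ge0.
Qed.

Lemma mxtrace_conj (R : realType) (r q : nat) (A : 'M[R]_r) (P : 'M[R]_(r, q)) :
  \tr (P^T *m A *m P) = \sum_j bform A (row j P^T) (row j P^T).
Proof.
apply: eq_bigr => j _; rewrite /bform.
rewrite -row_mul mxE [RHS]mxE; apply: eq_bigr => k _.
by rewrite [row _ _ _ _]mxE [(row _ _)^T _ _]mxE [row _ _ _ _]mxE [P^T _ _]mxE.
Qed.

(** Writing [C = V^T V] turns both traces into sums of quadratic forms over the rows of [V]. *)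
Lemma mxtrace_psd_le (R : realType) (r : nat) (A B C : 'M[R]_r) :
  (forall v, bform A v v <= bform B v v) -> psdmx C ->
  \tr (A *m C) <= \tr (B *m C).
Proof.
move=> AB /psdmx_gramP[V ->].
have E M : \tr (M *m (V^T *m V)) = \tr (V^T^T *m M *m V^T).
  by rewrite trmxK mulmxA mxtrace_mulC mulmxA.
by rewrite !E !mxtrace_conj ler_sum.
Qed.

Lemma mxtrace_psdM_ge0 (R : realType) (r : nat) (A B : 'M[R]_r) :
  psdmx A -> psdmx B -> 0 <= \tr (A *m B).
Proof.
move=> [_ A0] psdB; rewrite -[X in X <= _](mxtrace0 R r) -(mul0mx r B).
by apply: mxtrace_psd_le => // v; rewrite /bform mulmx0 mul0mx mxE; apply: A0.
Qed.

Lemma trmxX (R : realType) (r k : nat) (X : 'M[R]_r) : (X ^+ k)^T = X^T ^+ k.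
Proof. by elim: k => [|k IH]; rewrite ?trmx1 // exprS trmx_mul IH [RHS]exprSr. Qed.

(* X^j (1 + tX)^2 is a congruence of 1 or X according to the parity of j. *)
Lemma psdmx_expM (R : realType) (r j : nat) (t : R) (X : 'M[R]_r) :
  psdmx X -> psdmx (X ^+ j + (2 * t) *: X ^+ j.+1 + t ^+ 2 *: X ^+ j.+2).
Proof.
move=> Xp; have [XT _] := Xp; set P := X ^+ j./2 *m (1%:M + t *: X).
have PT : P^T = (1%:M + t *: X) *m X ^+ j./2.
  by rewrite trmx_mul trmxX raddfD /= [(t *: X)^T]linearZ /= trmx1 XT.
have := @psdmx_conj _ _ _ (X ^+ odd j) P.
have -> : P^T *m X ^+ odd j *m P
    = X ^+ j + (2 * t) *: X ^+ j.+1 + t ^+ 2 *: X ^+ j.+2.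
  have Xc i k : X ^+ i *m X ^+ k = X ^+ (i + k) by rewrite exprD.
  have -> : P^T *m X ^+ odd j *m P = (1%:M + t *: X)
      *m (X ^+ j./2 *m X ^+ odd j *m X ^+ j./2) *m (1%:M + t *: X).
    by rewrite PT /P !mulmxA.
  rewrite !Xc.
  have -> : (j./2 + odd j + j./2 = j)%N.
    by rewrite addnAC addnn addnC odd_double_half.
  have X1 i : X *m X ^+ i = X ^+ i.+1 by rewrite exprS.
  have X2 i : X ^+ i *m X = X ^+ i.+1 by rewrite exprSr.
  rewrite mulmxDl mul1mx -scalemxAl X1 mulmxDr mulmx1 mulmxDl -!scalemxAr.
  rewrite -!scalemxAl !X2 scalerA -expr2 addrA; congr (_ + _).
  by rewrite -addrA -scalerDl -mulr2n mulr_natl.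
by apply; case: (odd j); rewrite ?expr1 ?expr0 //; apply: psdmx1.
Qed.

(** * Trace moments *)

(** Log-convexity makes the ratios [b i.+1 / b i] nondecreasing, so the first one bounds all later
    ones from below. Positivity is carried along to allow the divisions. *)
Lemma logconvex_lower (R : realType) (b : nat -> R) (rho : R) (j : nat) :
  (forall i, b i.+1 ^+ 2 <= b i * b i.+2) -> 0 < rho -> 0 < b 0%N ->
  rho * b 0%N <= b 1%N -> rho ^+ j * b 0%N <= b j.
Proof.
move=> bb rho0 b0 b1.
have H i : 0 < b i /\ rho * b i <= b i.+1.
  elim: i => [//|i [bi bS]].
  have bi1 : 0 < b i.+1 by apply: lt_le_trans bS; rewrite mulr_gt0.
  split=> //; rewrite -(ler_pM2l bi); apply: le_trans (bb i).
  by rewrite expr2 mulrCA mulrA ler_wpM2r // ltW.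
elim: j => [|j IH]; first by rewrite mul1r.
apply: le_trans (H j).2; rewrite exprS -mulrA ler_wpM2l // ltW //.
Qed.

(** The same monotonicity of ratios, read backwards from the last one; a vanishing term is treated
    apart. *)
Lemma logconvex_upper (R : realType) (a : nat -> R) (rho : R) (K : nat) :
  (forall i, 0 <= a i) -> (forall i, a i.+1 ^+ 2 <= a i * a i.+2) ->
  0 <= rho -> a K.+1 <= rho * a K -> a K <= rho ^+ K * a 0%N.
Proof.
move=> a0 aa rho0; elim: K => [|K IH] aK; first by rewrite mul1r.
have aK' : a K.+1 <= rho * a K.
  have := a0 K.+1; rewrite le_eqVlt => /orP[/eqP <-|aS]; first by rewrite mulr_ge0.
  rewrite -(ler_pM2r aS) -expr2; apply: le_trans (aa K) _.
  by rewrite -mulrA mulrCA; apply: ler_wpM2l.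
apply: (le_trans aK'); rewrite exprS -mulrA ler_wpM2l //; exact: IH aK'.
Qed.

Definition moment (R : realType) (n r : nat) (B X : cube n -> 'M[R]_r)
    (j : nat) : R :=
  cube_mean (fun x => \tr (B x *m X x ^+ j)).

Lemma psdmxX (R : realType) (r j : nat) (X : 'M[R]_r) :
  psdmx X -> psdmx (X ^+ j).
Proof.
by move/(psdmx_expM j 0); rewrite mulr0 expr0n !scale0r !addr0.
Qed.

Lemma moment_ge0 (R : realType) (n r j : nat) (B X : cube n -> 'M[R]_r) :
  (forall x, psdmx (B x)) -> (forall x, psdmx (X x)) -> 0 <= moment B X j.
Proof.
move=> Bp Xp; apply: cube_mean_ge0 => x.
exact: mxtrace_psdM_ge0 (Bp x) (psdmxX j (Xp x)).
Qed.

(** This is the discriminant of the nonnegative quadratic [t |-> E Tr (B X^j (1 + t X)^2)]. *)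
Lemma moment_logconvex (R : realType) (n r j : nat) (B X : cube n -> 'M[R]_r) :
  (forall x, psdmx (B x)) -> (forall x, psdmx (X x)) ->
  moment B X j.+1 ^+ 2 <= moment B X j * moment B X j.+2.
Proof.
move=> Bp Xp; apply: discriminant_le0 => [|t]; first exact: moment_ge0.
rewrite /moment mulrAC -cube_meanZ (mulrC (moment _ _ _)) -cube_meanZ.
rewrite -!cube_meanD; apply: cube_mean_ge0 => x.
have := mxtrace_psdM_ge0 (Bp x) (psdmx_expM j t (Xp x)).
by rewrite !mulmxDr -!scalemxAr !raddfD /= !mxtraceZ.
Qed.

(** Cauchy-Schwarz for each row of a Gram factor [V] of [B], summed over the rows. *)
Lemma bform_le_tr (R : realType) (r : nat) (B : 'M[R]_r) (v : 'rV[R]_r) :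
  psdmx B -> bform B v v <= \tr B * bform 1%:M v v.
Proof.
move=> /psdmx_gramP[V ->].
have dot (u w : 'rV[R]_r) : bform 1%:M u w = \sum_k u 0 k * w 0 k.
  by rewrite /bform mulmx1 mxE; apply: eq_bigr => k _; rewrite mxE.
have -> : bform (V^T *m V) v v = \sum_i bform 1%:M (row i V) v ^+ 2.
  rewrite [LHS]/bform.
  have -> : v *m (V^T *m V) *m v^T = (V *m v^T)^T *m (V *m v^T).
    by rewrite trmx_mul trmxK !mulmxA.
  rewrite mxE; apply: eq_bigr => i _; rewrite [_^T _ _]mxE -expr2 dot.
  by rewrite [(V *m v^T) _ _]mxE; congr (_ ^+ 2); apply: eq_bigr => k _;
    rewrite !mxE.
have -> : \tr (V^T *m V) = \sum_i bform 1%:M (row i V) (row i V).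
  rewrite mxtrace_mulC; apply: eq_bigr => i _; rewrite dot mxE.
  by apply: eq_bigr => k _; rewrite !mxE.
rewrite mulr_suml; apply: ler_sum => i _; apply: psdmx_cauchy; exact: psdmx1.
Qed.

(** Compares two growth rates: [rho1] drives up the moments weighted by [B], [rho2] holds down the
    unweighted ones, and [B <= T] relates them at index [k]. The factor [r] is the unweighted moment
    of index 0. *)
Lemma moment_gap (R : realType) (n r k : nat) (B X : cube n -> 'M[R]_r)
    (T rho1 rho2 : R) :
  (forall x, psdmx (B x)) -> (forall x, psdmx (X x)) ->
  (forall x, \tr (B x) <= T) -> 0 < rho1 -> 0 <= rho2 ->
  0 < moment B X 0 -> rho1 * moment B X 0 <= moment B X 1 ->
  moment (fun=> 1%:M) X k.+1 <= rho2 * moment (fun=> 1%:M) X k ->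
  rho1 ^+ k * moment B X 0 <= T * rho2 ^+ k * r%:R.
Proof.
move=> Bp Xp BT rho10 rho20 b0 b1 ak.
have T0 : 0 <= T.
  apply: le_trans (BT [ffun=> false]); rewrite -[X in \tr X]mulmx1.
  exact: mxtrace_psdM_ge0 (Bp _) (psdmx1 _ _).
have Ip (x : cube n) : psdmx (1%:M : 'M[R]_r) by apply: psdmx1.
apply: le_trans (logconvex_lower k _ rho10 b0 b1) _ => [i|].
  exact: moment_logconvex.
apply: (@le_trans _ _ (T * moment (fun=> 1%:M) X k)).
  rewrite -cube_meanZ; apply: ler_cube_mean => x.
  rewrite -mxtraceZ scalemxAl; apply: mxtrace_psd_le; last exact: psdmxX.
  move=> v; apply: le_trans (bform_le_tr _ (Bp x)) _.
  rewrite [in X in _ <= X]/bform -scalemxAr -scalemxAl mxE -/(bform _ _ _).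
  by rewrite ler_wpM2r //; apply: (Ip x).2.
rewrite -mulrA ler_wpM2l //.
have -> : r%:R = moment (fun=> 1%:M) X 0.
  rewrite /moment; under cube_mean_ext do rewrite expr0 mul1mx.
  by rewrite mxtrace1 cube_mean_cst.
apply: logconvex_upper => // i; first exact: moment_ge0.
exact: moment_logconvex.
Qed.

(** * Operator-valued pseudo-expectations *)

Definition mx_fdeg_le (R : realType) (n r k : nat) (P : cube n -> 'M[R]_r) :
    Prop :=
  forall i j, fdeg_le k (fun x => P x i j).

Lemma mx_fdeg_leX (R : realType) (n r k l : nat) (X : cube n -> 'M[R]_r) :
  mx_fdeg_le k X -> mx_fdeg_le (l * k) (fun x => X x ^+ l).
Proof.
move=> Xk; elim: l => [|l IH] i j.
  apply: (@fdeg_le_ext _ _ _ (fun=> (i == j)%:R)) => [x|].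
    by rewrite expr0 mxE.
  exact: fdeg_le_cst.
apply: (@fdeg_le_ext _ _ _ (fun x => \sum_h X x i h * (X x ^+ l) h j)) => [x|].
  by rewrite exprS mxE.
by rewrite mulSn; apply: fdeg_le_sum => h _; apply: fdeg_leM.
Qed.

Lemma mxtrace_gram (R : realType) (r q : nat) (Y : 'M[R]_(q, r)) :
  \tr (Y *m Y^T) = \sum_i \sum_j Y i j ^+ 2.
Proof.
apply: eq_bigr => i _; rewrite mxE; apply: eq_bigr => j _.
by rewrite mxE expr2.
Qed.

Lemma exchange_big3 (R : realType) (I J K : finType) (P : pred K)
    (F : I -> J -> K -> R) :
  \sum_i \sum_j \sum_(k | P k) F i j k = \sum_(k | P k) \sum_i \sum_j F i j k.
Proof.
by rewrite [RHS]exchange_big; apply: eq_bigr => i _; rewrite exchange_big.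
Qed.

(* Apply pseudo_density_lower to the entries of V_S P(x), where A_S = V_S^T V_S,
   and Parseval to the Fourier coefficients of P. *)
Lemma pseudo_density_trace (R : realType) (n m d r : nat) (D : cube m -> R)
    (N tau M : R) (S : msubset n m) (A : 'M[R]_r) (P : cube n -> 'M[R]_r) :
  pseudo_density d D -> (forall y, `|D y| <= N) -> 0 < tau <= 1 ->
  psdmx A -> (forall v, bform A v v <= M * bform 1%:M v v) ->
  - (N * (tau * cube_mean (fun x => \tr (A *m (P x *m (P x)^T))) + 2 / tau *
      (M * \sum_(U : {set 'I_n} | (d < 2 * #|U :&: val S|)%N)
             \sum_i \sum_j fourier (fun x => P x i j) U ^+ 2)))
    <= cube_mean (fun x => D (restrict S x) * \tr (A *m (P x *m (P x)^T))).
Proof.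
move=> Dd DN taub Ap AM; have [V VE] := psdmx_gramP Ap.
have trE (Q : 'M[R]_r) :
    \tr (A *m (Q *m Q^T)) = \sum_i \sum_j (V *m Q) i j ^+ 2.
  rewrite -mxtrace_gram VE trmx_mul -mulmxA mxtrace_mulC.
  by rewrite !mulmxA.
have N0 : 0 <= N by apply: le_trans (normr_ge0 _) (DN [ffun=> false]).
have tau0 : 0 < tau by case/andP: taub.
have -> : cube_mean (fun x => D (restrict S x) * \tr (A *m (P x *m (P x)^T)))
    = \sum_i \sum_j
        cube_mean (fun x => D (restrict S x) * (V *m P x) i j ^+ 2).
  under eq_bigr do rewrite -cube_mean_sum; rewrite -cube_mean_sum.
  apply: cube_mean_ext => x; rewrite trE mulr_sumr.
  by under eq_bigr do rewrite mulr_sumr.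
apply: le_trans (ler_sum _ (fun i _ => ler_sum _ (fun j _ =>
  pseudo_density_lower S (fun x => (V *m P x) i j) Dd DN taub))).
under [X in _ <= X]eq_bigr do rewrite sumrN; rewrite sumrN lerN2.
under eq_bigr do rewrite -mulr_sumr; rewrite -mulr_sumr ler_wpM2l //.
under eq_bigr do rewrite big_split /= -!mulr_sumr; rewrite big_split /=.
rewrite -[X in X + _]mulr_sumr -[X in _ + X]mulr_sumr; apply: lerD.
  under eq_bigr do rewrite -cube_mean_sum; rewrite -cube_mean_sum.
  apply: ler_wpM2l; first exact: ltW.
  by apply: ler_cube_mean => x; rewrite trE.
apply: ler_wpM2l; first by rewrite divr_ge0 // ltW.
rewrite exchange_big3 mulr_sumr; apply: ler_sum => U _.
pose Q := \matrix_(i, j) fourier (fun x => P x i j) U.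
have VQ i j : fourier (fun x => (V *m P x) i j) U = (V *m Q) i j.
  rewrite mxE; under eq_bigr do rewrite mxE -fourierZ; rewrite -fourier_sum.
  by apply: fourier_ext => x; rewrite mxE.
have -> : \sum_i \sum_j fourier (fun x => P x i j) U ^+ 2 = \tr (Q *m Q^T).
  rewrite mxtrace_gram; apply: eq_bigr => i _; apply: eq_bigr => j _.
  by rewrite mxE.
under eq_bigr do under eq_bigr do rewrite VQ.
rewrite -trE -mxtraceZ -[M *: _]mul_scalar_mx.
apply: mxtrace_psd_le.
  move=> v; apply: le_trans (AM v) _.
  rewrite /bform mulmx1 mul_mx_scalar -scalemxAl [X in _ <= X]mxE.
  by [].
by have := psdmx_gram Q^T; rewrite trmxK.
Qed.

(** The operator Λ: for a factorization of the pattern matrix, its trace against [B x] is the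
    average of [D (x_S) f (x_S)] over [S]. *)
Definition mean_op (R : realType) (n m r : nat) (D : cube m -> R)
    (A : msubset n m -> 'M[R]_r) (x : cube n) : 'M[R]_r :=
  #|msubset n m|%:R^-1 *: \sum_S D (restrict S x) *: A S.

Lemma card_msubset_gt0 (R : realType) (n m : nat) : (m <= n)%N ->
  0 < #|msubset n m|%:R :> R.
Proof. by move=> mn; rewrite ltr0n card_msubset bin_gt0. Qed.

(** Average [pseudo_density_trace] over [S]. The first [tau] term is controlled because the [A S]
    average to at most the identity, the other because a random [S] rarely meets a set of size at
    most [K] in more than [d / 2] points. *)
Lemma mean_op_lower (R : realType) (n m d r K : nat) (D : cube m -> R)
    (N tau M : R) (A : msubset n m -> 'M[R]_r) (P : cube n -> 'M[R]_r) :
  (0 < n)%N -> (m <= n)%N ->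
  pseudo_density d D -> (forall y, `|D y| <= N) -> 0 < tau <= 1 -> 0 <= M ->
  (forall S, psdmx (A S)) ->
  (forall S v, bform (A S) v v <= M * bform 1%:M v v) ->
  (forall v, bform (\sum_S A S) v v <= #|msubset n m|%:R * bform 1%:M v v) ->
  mx_fdeg_le K P ->
  - (N * (tau + 2 / tau * (M * ((K * m)%:R / n%:R) ^+ (d./2).+1))
       * cube_mean (fun x => \tr (P x *m (P x)^T)))
    <= cube_mean (fun x => \tr (mean_op D A x *m (P x *m (P x)^T))).
Proof.
move=> n0 mn Dd DN taub M0 Ap AM Asum PK.
have N0 : 0 <= N by apply: le_trans (normr_ge0 _) (DN [ffun=> false]).
have tau0 : 0 < tau by case/andP: taub.
have c0 := card_msubset_gt0 R mn; set w := #|msubset n m|%:R in c0 Asum *.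
set E := cube_mean (fun x => \tr (P x *m (P x)^T)).
pose c U := \sum_i \sum_j fourier (fun x => P x i j) U ^+ 2.
have cE : \sum_U c U = E.
  rewrite /c -exchange_big3.
  under eq_bigr do under eq_bigr do rewrite -parseval.
  under eq_bigr do rewrite -cube_mean_sum; rewrite -cube_mean_sum.
  by apply: cube_mean_ext => x; rewrite mxtrace_gram.
have -> : cube_mean (fun x => \tr (mean_op D A x *m (P x *m (P x)^T)))
    = w^-1 * \sum_S cube_mean (fun x =>
        D (restrict S x) * \tr (A S *m (P x *m (P x)^T))).
  rewrite -cube_mean_sum -cube_meanZ; apply: cube_mean_ext => x.
  rewrite /mean_op -scalemxAl mxtraceZ mulmx_suml raddf_sum /=.
  by congr (_ * _); apply: eq_bigr => S _; rewrite -scalemxAl mxtraceZ.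
rewrite ler_pdivlMl // mulrN.
apply: le_trans (ler_sum _ (fun S _ =>
  pseudo_density_trace S P Dd DN taub (Ap S) (AM S))).
rewrite sumrN lerN2 -mulr_sumr big_split /= -!mulr_sumr.
have -> : w * (N * (tau + 2 / tau * (M * ((K * m)%:R / n%:R) ^+ (d./2).+1)) * E)
    = N * (tau * (w * E) + 2 / tau * (M *
        (w * (((K * m)%:R / n%:R) ^+ (d./2).+1 * E)))) by ring.
rewrite ler_wpM2l //; apply: lerD.
  apply: ler_wpM2l; first exact: ltW.
  rewrite -cube_mean_sum /E -cube_meanZ.
  apply: ler_cube_mean => x.
  rewrite -raddf_sum /= -mulmx_suml -mxtraceZ -[w *: _]mul_scalar_mx.
  apply: mxtrace_psd_le.
    move=> v; apply: le_trans (Asum v) _.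
    by rewrite /bform mulmx1 mul_mx_scalar -scalemxAl [X in _ <= X]mxE.
  by have := psdmx_gram (P x)^T; rewrite trmxK.
apply: ler_wpM2l; first by rewrite divr_ge0 // ltW.
rewrite ler_wpM2l // -cE.
apply: (sum_high_le d n0 mn) => [U|U KU].
  by rewrite sumr_ge0 // => i _; rewrite sumr_ge0 // => j _; rewrite sqr_ge0.
by rewrite /c big1 // => i _; rewrite big1 // => j _; rewrite PK ?expr0n.
Qed.

Lemma restrict_flip (n m : nat) (S : msubset n m) (i : 'I_n) (x : cube n) :
  i \notin val S -> restrict S (flip i x) = restrict S x.
Proof.
move=> iS; apply/ffunP => j; rewrite !ffunE; case: eqP => // eqji.
by rewrite -eqji msubset_nth_in in iS.
Qed.

Lemma mx_fdeg_le_mean_op (R : realType) (n m r : nat) (D : cube m -> R)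
    (A : msubset n m -> 'M[R]_r) : mx_fdeg_le m (mean_op D A).
Proof.
move=> i j; apply: (@fdeg_le_ext _ _ _ (fun x => #|msubset n m|%:R^-1
    * \sum_S A S i j * D (restrict S x))) => [x|].
  rewrite !mxE summxE; congr (_ * _); apply: eq_bigr => S _.
  by rewrite mxE mulrC.
apply: fdeg_leZ; apply: fdeg_le_sum => S _; apply: fdeg_leZ.
rewrite -{1}(eqP (valP S)); apply: fdeg_le_junta => l x lS.
by rewrite restrict_flip.
Qed.

Lemma bformE_add (R : realType) (r : nat) (A B : 'M[R]_r) (v : 'rV[R]_r) :
  bform (A + B) v v = bform A v v + bform B v v.
Proof. by rewrite /bform mulmxDr mulmxDl mxE. Qed.

Lemma bformE_scale (R : realType) (r : nat) (c : R) (A : 'M[R]_r)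
    (v : 'rV[R]_r) : bform (c *: A) v v = c * bform A v v.
Proof. by rewrite /bform -scalemxAr -scalemxAl mxE. Qed.

Lemma bformE_sum (R : realType) (r : nat) (I : finType) (A : I -> 'M[R]_r)
    (v : 'rV[R]_r) : bform (\sum_i A i) v v = \sum_i bform (A i) v v.
Proof. by rewrite /bform mulmx_sumr mulmx_suml summxE. Qed.

Lemma mean_op_norm (R : realType) (n m r : nat) (D : cube m -> R) (N : R)
    (A : msubset n m -> 'M[R]_r) (x : cube n) (v : 'rV[R]_r) :
  (m <= n)%N -> (forall y, `|D y| <= N) -> (forall S, psdmx (A S)) ->
  (forall v, bform (\sum_S A S) v v <= #|msubset n m|%:R * bform 1%:M v v) ->
  `|bform (mean_op D A x) v v| <= N * bform 1%:M v v.
Proof.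
move=> mn DN Ap Asum; have c0 := card_msubset_gt0 R mn.
have N0 : 0 <= N by apply: le_trans (normr_ge0 _) (DN [ffun=> false]).
rewrite bformE_scale normrM.
rewrite [X in X * _]ger0_norm ?invr_ge0 ?ler0n // ler_pdivrMl //.
rewrite mulrCA; apply: le_trans (ler_wpM2l N0 (Asum v)).
rewrite !bformE_sum mulr_sumr; apply: le_trans (ler_norm_sum _ _ _) _.
apply: ler_sum => S _; rewrite bformE_scale normrM.
have AS0 : 0 <= bform (A S) v v by apply: (Ap S).2.
by rewrite [X in _ * X]ger0_norm // ler_wpM2r.
Qed.

Lemma mean_op_sym (R : realType) (n m r : nat) (D : cube m -> R)
    (A : msubset n m -> 'M[R]_r) (x : cube n) :
  (forall S, psdmx (A S)) -> (mean_op D A x)^T = mean_op D A x.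
Proof.
move=> Ap; rewrite /mean_op [LHS]linearZ /= raddf_sum /=; congr (_ *: _).
by apply: eq_bigr => S _; rewrite [LHS]linearZ /= (Ap S).1.
Qed.

(** Applies [moment_gap] to [X = 1 - Λ/N]. The exponent is even so that [X ^+ (k * 2)] is [P P^T]
    with [P = X ^+ k] of degree at most [k m], as [mean_op_lower] requires. *)
Lemma psd_rank_growth (R : realType) (n m d r k : nat) (D : cube m -> R)
    (N tau M T eps : R) (A : msubset n m -> 'M[R]_r) (B : cube n -> 'M[R]_r) :
  (0 < n)%N -> (m <= n)%N ->
  pseudo_density d D -> 0 < N -> (forall y, `|D y| <= N) -> 0 < tau <= 1 ->
  0 <= M -> (forall S, psdmx (A S)) ->
  (forall S v, bform (A S) v v <= M * bform 1%:M v v) ->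
  (forall v, bform (\sum_S A S) v v <= #|msubset n m|%:R * bform 1%:M v v) ->
  (forall x, psdmx (B x)) -> (forall x, \tr (B x) <= T) -> 0 < T -> 0 < eps ->
  cube_mean (fun x => \tr (mean_op D A x *m B x)) < - eps ->
  (1 + eps / (N * T)) ^+ (k * 2) * (eps / N)
    <= T * (1 + (tau + 2 / tau *
         (M * ((k * m * m)%:R / n%:R) ^+ (d./2).+1))) ^+ (k * 2) * r%:R.
Proof.
move=> n0 mn Dd N0 DN taub M0 Ap AM Asum Bp BT T0 eps0 corr.
set delta := tau + _.
pose L := mean_op D A; pose X x : 'M[R]_r := 1%:M - N^-1 *: L x.
have LN x v : `|bform (L x) v v| <= N * bform 1%:M v v.
  exact: mean_op_norm.
have XE x v : bform (X x) v v = bform 1%:M v v - N^-1 * bform (L x) v v.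
  by rewrite /X -scaleNr bformE_add bformE_scale mulNr.
have Xp x : psdmx (X x).
  split=> [|v].
    by rewrite /X raddfB /= trmx1 [(_ *: _)^T]linearZ /= mean_op_sym.
  rewrite -/(bform _ _ _) XE subr_ge0 ler_pdivrMl //.
  exact: le_trans (ler_norm _) (LN x v).
have X2 x v : bform (X x) v v <= bform (2%:M) v v.
  have /andP[lo _] : - (N * bform 1%:M v v) <= bform (L x) v v
      <= N * bform 1%:M v v by rewrite -ler_norml.
  have : - bform 1%:M v v <= N^-1 * bform (L x) v v.
    by rewrite ler_pdivlMl // mulrN.
  by rewrite XE -[2%:M]scalemx1 bformE_scale => h; lra.
have m1 : moment B X 1
    = moment B X 0 - N^-1 * cube_mean (fun x => \tr (L x *m B x)).
  rewrite -cube_meanZ -cube_meanB; apply: cube_mean_ext => x.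
  rewrite expr1 expr0 /X mulmxBr mulmx1 raddfB /= -scalemxAr mxtraceZ.
  by rewrite [in X in _ * X]mxtrace_mulC ?mulmx1.
have m1_gt : moment B X 0 + eps / N < moment B X 1.
  by rewrite m1 ltrD2l mulrC -mulrN ltr_pM2l ?invr_gt0 // ltrNr.
(* Since [X <= 2], the first moment is at most twice the zeroth; with [m1_gt] this forces the zeroth
   to be at least [eps / N]. *)
have m1_le : moment B X 1 <= 2 * moment B X 0.
  rewrite -cube_meanZ; apply: ler_cube_mean => x.
  rewrite expr1 expr0 mulmx1 -mxtraceZ -mul_scalar_mx mxtrace_mulC.
  by apply: mxtrace_psd_le.
have m0_ge : eps / N <= moment B X 0 by lra.
have epsN : 0 < eps / N by rewrite divr_gt0.
have m0_gt : 0 < moment B X 0 by apply: lt_le_trans m0_ge.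
have m0_le : moment B X 0 <= T.
  rewrite -(cube_mean_cst n T); apply: ler_cube_mean => x.
  by rewrite expr0 mulmx1.
have q0 : 0 <= delta.
  case/andP: taub => tau0 _.
  apply: addr_ge0; first exact: ltW.
  apply: mulr_ge0; first by rewrite divr_ge0 // ltW.
  by rewrite mulr_ge0 // exprn_ge0 // divr_ge0.
have NT0 : 0 < N * T by rewrite mulr_gt0.
have epsNT : 0 < eps / (N * T) by rewrite divr_gt0.
apply: (@le_trans _ _ ((1 + eps / (N * T)) ^+ (k * 2) * moment B X 0)).
  by rewrite ler_wpM2l // exprn_ge0 // addr_ge0 // ltW.
apply: (moment_gap Bp Xp BT) => //.
- by rewrite ltr_wpDr // ltW.
- by rewrite addr_ge0.
(* The zeroth moment is at most [T], so the additive gain [eps / N] is a relative gain of at least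
   [eps / (N * T)]. *)
- apply: le_trans (ltW m1_gt); rewrite mulrDl mul1r lerD2l.
  have -> : eps / (N * T) * moment B X 0 = eps / N * (moment B X 0 / T).
    by rewrite invfM; ring.
  by apply: ler_piMr; [exact: ltW|rewrite ler_pdivrMr // mul1r].
have Pk : mx_fdeg_le (k * m) (fun x => X x ^+ k).
  apply: mx_fdeg_leX => i j.
  apply: (@fdeg_le_ext _ _ _ (fun x => (i == j)%:R + (- N^-1) * L x i j)).
    by move=> x; rewrite !mxE mulNr.
  apply: fdeg_leD; first exact: fdeg_le_cst.
  exact/fdeg_leZ/mx_fdeg_le_mean_op.
have := mean_op_lower n0 mn Dd DN taub M0 Ap AM Asum Pk.
rewrite -/delta -/L.
have XX x : X x ^+ k *m (X x ^+ k)^T = X x ^+ (k * 2).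
  by rewrite trmxX (Xp x).1 muln2 -addnn exprD.
under cube_mean_ext do rewrite XX.
under [X in _ <= X]cube_mean_ext do rewrite XX.
move=> low.
have -> : moment (fun=> 1%:M) X (k * 2).+1 = moment (fun=> 1%:M) X (k * 2)
    - N^-1 * cube_mean (fun x => \tr (L x *m X x ^+ (k * 2))).
  rewrite -cube_meanZ -cube_meanB; apply: cube_mean_ext => x.
  rewrite !mul1mx exprS /X -mxtraceZ -raddfB scalemxAl -/(X x) /=.
  by rewrite -[in X in _ = \tr (X - _)](mul1mx (X x ^+ _)) -mulmxBl.
have -> : moment (fun=> 1%:M) X (k * 2)
    = cube_mean (fun x => \tr (X x ^+ (k * 2))).
  by apply: cube_mean_ext => x; rewrite mul1mx.
rewrite mulrDl mul1r lerD2l lerNl -mulrN ler_pdivlMl //.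
apply: le_trans low; rewrite le_eqVlt; apply/orP; left; apply/eqP; ring.
Qed.

(** * Rescaling a psd factorization *)

Lemma bform_gram (R : realType) (r q : nat) (V : 'M[R]_(q, r)) (v : 'rV[R]_r) :
  bform (V^T *m V) v v = \sum_k (row k V *m v^T) 0 0 ^+ 2.
Proof.
rewrite /bform (_ : v *m (V^T *m V) *m v^T = (V *m v^T)^T *m (V *m v^T)).
  rewrite mxE; apply: eq_bigr => k _; rewrite [_^T _ _]mxE -expr2.
  by rewrite -row_mul [row _ _ _ _]mxE.
by rewrite trmx_mul trmxK !mulmxA.
Qed.

Lemma bform1_gt0 (R : realType) (r : nat) (v : 'rV[R]_r) :
  v != 0 -> 0 < bform 1%:M v v.
Proof.
move=> v0; rewrite lt_def (psdmx1 _ _).2 andbT; apply: contra_neq v0.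
rewrite /bform mulmx1 mxE => /eqP; rewrite psumr_eq0 => [/allP sq0|k _].
  apply/rowP => k; rewrite mxE; apply/eqP.
  by have := sq0 k (mem_index_enum _); rewrite mxE -expr2 sqrf_eq0.
by rewrite mxE -expr2 sqr_ge0.
Qed.

(** In the semidefinite order, the rank-one form of [v] lies below some [A i]. *)
Definition dominated (R : realType) (r : nat) (I : finType) (A : I -> 'M[R]_r)
    (v : 'rV[R]_r) : Prop :=
  exists i, forall w, (v *m w^T) 0 0 ^+ 2 <= bform (A i) w w.

Lemma det_norm_le (R : realType) (r : nat) (Z : 'M[R]_r) (K : R) :
  (forall i j, `|Z i j| <= K) -> `|\det Z| <= #|{: {perm 'I_r}}|%:R * K ^+ r.
Proof.
move=> ZK; apply: le_trans (ler_norm_sum _ _ _) _.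
rewrite mulr_natl -sumr_const; apply: ler_sum => s _.
rewrite normrM normrX normrN1 expr1n mul1r normr_prod.
rewrite -[r in K ^+ r]card_ord -prodr_const; apply: ler_prod => i _.
by rewrite normr_ge0 ZK.
Qed.

(** The numerator in Cramer's rule, by cofactor expansion along the replaced row. *)
Lemma det_replace_row (R : realType) (r : nat) (Z : 'M[R]_r) (v : 'rV[R]_r)
    (k : 'I_r) :
  \det (\matrix_(i, j) (if i == k then v 0 j else Z i j)) = (v *m \adj Z) 0 k.
Proof.
rewrite (expand_det_row _ k) mxE; apply: eq_bigr => j _.
rewrite !mxE eqxx; congr (_ * (_ * \det _)).
by apply/matrixP => i l; rewrite !mxE eq_sym (negbTE (neq_lift _ _)).
Qed.

(* Z has almost maximal determinant among the matrices with dominated rows; by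
   Cramer's rule every dominated vector then has coordinates at most 2 in the
   rows of Z. *)
Lemma auerbach_basis (R : realType) (r : nat) (I : finType) (A : I -> 'M[R]_r)
    (i0 : I) (delta : R) :
  (forall i, psdmx (A i)) -> 0 < delta ->
  (forall v, delta * bform 1%:M v v <= bform (A i0) v v) ->
  exists Z : 'M[R]_r, (forall k, dominated A (row k Z)) /\
    (forall i v, bform (A i) v v <= 4 * r%:R * bform (Z^T *m Z) v v).
Proof.
move=> Ap delta0 Adelta.
pose E : set R := [set e | exists Z : 'M[R]_r,
  (forall k, dominated A (row k Z)) /\ e = `|\det Z|]%classic.
(* A multiple of the identity has dominated rows, so the supremum of the determinants is
   positive. *)
have scal_dom k : dominated A (row k (Num.sqrt delta)%:M).
  exists i0 => w; apply: le_trans (Adelta w).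
  rewrite -[_%:M]scalemx1 linearZ /= row1 -scalemxAl mxE exprMn.
  rewrite sqr_sqrtr ?(ltW delta0) // ler_pM2l //.
  rewrite -{1}[1%:M]mulmx1 -{1}trmx1 bform_gram (bigD1 k) //= row1 lerDl.
  by rewrite sumr_ge0 // => j _; rewrite sqr_ge0.
have det0 : 0 < `|\det ((Num.sqrt delta)%:M : 'M[R]_r)|.
  by rewrite det_scalar normr_gt0 expf_neq0 // gt_eqF // sqrtr_gt0.
have supE : has_sup E.
  split; first by exists `|\det ((Num.sqrt delta)%:M : 'M[R]_r)|;
    exists (Num.sqrt delta)%:M.
  (* The squared entries of a dominated vector are at most [K - 1]; the added 1 makes [K] bound the
     entries themselves. *)
  pose K := 1 + \sum_i \sum_k A i k k.
  have Akk i k : A i k k = bform (A i) (delta_mx 0 k) (delta_mx 0 k).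
    by rewrite /bform -rowE trmx_delta -colE !mxE.
  have Akk0 i k : 0 <= A i k k by rewrite Akk; apply: (Ap i).2.
  exists (#|{: {perm 'I_r}}|%:R * K ^+ r) => _ [Z [Zdom ->]].
  apply: det_norm_le => k l; have [i /(_ (delta_mx 0 l))] := Zdom k.
  rewrite -Akk trmx_delta -colE !mxE => ZA.
  have AK : A i l l <= K - 1.
    rewrite /K addrAC subrr add0r (bigD1 i) //= (bigD1 l) //= -addrA lerDl.
    by rewrite addr_ge0 // sumr_ge0 // => ? _; rewrite sumr_ge0.
  have K0 : 0 <= K by have := Akk0 i l; lra.
  rewrite -ler_sqr ?nnegrE // real_normK ?num_real //.
  have := Akk0 i l; nra.
(* The slack is half of a feasible determinant, so [|\det Z|] is at least half the supremum, whence
   coordinates up to 2. *)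
have [_ [Z [Zdom ->]] Zsup] := sup_adherent (divr_gt0 det0 (ltr0n R 2)) supE.
have sup_ge Z' : (forall k, dominated A (row k Z')) -> `|\det Z'| <= sup E.
  by move=> Z'dom; apply: (sup_upper_bound supE); exists Z'.
have {}Zsup : sup E <= 2 * `|\det Z|.
  have := sup_ge _ scal_dom; lra.
have detZ : 0 < `|\det Z|.
  by have := sup_ge _ scal_dom; lra.
exists Z; split=> // i v.
have [Av|Av] := ltP 0 (bform (A i) v v); last first.
  by rewrite (le_trans Av) // mulr_ge0 ?mulr_ge0 //; apply: (psdmx_gram Z).2.
pose s := Num.sqrt (bform (A i) v v).
have s0 : 0 < s by rewrite sqrtr_gt0.
have sE : s ^+ 2 = bform (A i) v v by rewrite sqr_sqrtr // ltW.
(* By Cauchy-Schwarz this vector is dominated, and the form of [A i] at [v] is the square of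
   [u *m v^T]. *)
pose u := s^-1 *: (v *m A i).
have u_dom : dominated A u.
  exists i => w; rewrite /u -scalemxAl mxE exprMn exprVn sE.
  by rewrite ler_pdivrMl //; apply: psdmx_cauchy.
have Zunit : Z \in unitmx by rewrite unitmxE unitfE -normr_gt0.
pose c := u *m invmx Z.
have cZ : c *m Z = u by rewrite mulmxKV.
have c2 k : c 0 k ^+ 2 <= 4.
  have -> : c 0 k = (\det Z)^-1 * (u *m \adj Z) 0 k.
    by rewrite /c /invmx Zunit -scalemxAr mxE.
  rewrite -det_replace_row; set Z' := \matrix_(_, _) _.
  have Z'dom : forall l, dominated A (row l Z').
    move=> l; case: (eqVneq l k) => [->|lk].
      rewrite (_ : row k Z' = u) //.
      by apply/rowP => j; rewrite !mxE eqxx.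
    rewrite (_ : row l Z' = row l Z) //.
    by apply/rowP => j; rewrite !mxE (negbTE lk).
  have := le_trans (sup_ge _ Z'dom) Zsup => le2.
  rewrite exprMn exprVn -[\det Z ^+ 2]real_normK ?num_real //.
  rewrite ler_pdivrMl ?exprn_gt0 // -[\det Z' ^+ 2]real_normK ?num_real //.
  rewrite mulrC (_ : 4 = 2 ^+ 2); last by ring.
  by rewrite -exprMn ler_sqr // nnegrE mulr_ge0.
have -> : bform (A i) v v = (u *m v^T) 0 0 ^+ 2.
  rewrite /u -scalemxAl mxE -/(bform _ _ _) -sE.
  by clearbody s; field; rewrite gt_eqF.
rewrite -cZ -mulmxA.
have -> : (c *m (Z *m v^T)) 0 0 = bform 1%:M c (Z *m v^T)^T.
  by rewrite /bform mulmx1 trmxK.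
apply: le_trans (psdmx_cauchy _ _ (psdmx1 _ _)) _.
have -> : bform 1%:M (Z *m v^T)^T (Z *m v^T)^T = bform (Z^T *m Z) v v.
  by rewrite /bform mulmx1 trmxK trmx_mul trmxK !mulmxA.
apply: ler_wpM2r; first exact: (psdmx_gram Z).2.
rewrite /bform mulmx1 mxE [4 * _]mulr_natr.
rewrite -[X in _ <= _ *+ X]card_ord -sumr_const.
by apply: ler_sum => k _; rewrite [c^T _ _]mxE -expr2.
Qed.

(** Change coordinates by a Gram factor [U] of [W], the mean of the [A i] plus [r^-1 Z^T Z]. The
    first summand bounds the mean of the new matrices by the identity; the second bounds each of
    them, through [A i <= 4 r Z^T Z <= 4 r^2 W]. *)
Lemma psd_scaling (R : realType) (r : nat) (I J : finType) (A : I -> 'M[R]_r)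
    (B : J -> 'M[R]_r) (i0 : I) (delta : R) : (0 < r)%N ->
  (forall i, psdmx (A i)) -> (forall j, psdmx (B j)) -> 0 < delta ->
  (forall i v, delta * bform 1%:M v v <= bform (A i) v v) ->
  (forall i j, \tr (A i *m B j) <= 2) ->
  exists (A' : I -> 'M[R]_r) (B' : J -> 'M[R]_r),
    [/\ forall i, psdmx (A' i), forall j, psdmx (B' j) &
        forall i j, \tr (A' i *m B' j) = \tr (A i *m B j)] /\
    [/\ forall j, \tr (B' j) <= 4,
        forall i v, bform (A' i) v v <= 4 * r%:R ^+ 2 * bform 1%:M v v &
        forall v, bform (\sum_i A' i) v v <= #|I|%:R * bform 1%:M v v].
Proof.
move=> r0 Ap Bp delta0 Adelta AB2.
have [Z [Zdom AZ]] := auerbach_basis Ap delta0 (Adelta i0).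
have rR0 : 0 < r%:R :> R by rewrite ltr0n.
have card0 : 0 < #|I|%:R :> R by rewrite ltr0n; apply/card_gt0P; exists i0.
pose W := #|I|%:R^-1 *: (\sum_i A i) + r%:R^-1 *: (Z^T *m Z).
have sumAp : psdmx (\sum_i A i) by apply: psdmx_sum.
have WE v : bform W v v = #|I|%:R^-1 * bform (\sum_i A i) v v
    + r%:R^-1 * bform (Z^T *m Z) v v by rewrite bformE_add !bformE_scale.
have Z0 v : 0 <= r%:R^-1 * bform (Z^T *m Z) v v.
  by rewrite mulr_ge0 ?invr_ge0 //; apply: (psdmx_gram Z).2.
have A0 v : 0 <= #|I|%:R^-1 * bform (\sum_i A i) v v.
  by rewrite mulr_ge0 ?invr_ge0 //; apply: sumAp.2.
have Wp : psdmx W.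
  by apply: psdmxD; apply: psdmxZ; rewrite ?invr_ge0 //; apply: psdmx_gram.
have [U UE] := psdmx_gramP Wp.
have WA v : bform (\sum_i A i) v v <= #|I|%:R * bform W v v.
  by rewrite -ler_pdivrMl // WE lerDl.
have WZ v : bform (Z^T *m Z) v v <= r%:R * bform W v v.
  by rewrite -ler_pdivrMl // WE lerDr.
(* A vector in the kernel would annihilate the form of [W], against the definiteness of [A i0]. *)
have Uunit : U \in unitmx.
  rewrite unitmxE unitfE -det_tr; apply/det0P => -[v v0 vU].
  have := WA v; rewrite UE {2}/bform mulmxA vU !mul0mx [X in _ * X]mxE mulr0.
  rewrite bformE_sum leNgt => /negP; apply.
  apply: lt_le_trans (_ : 0 < delta * bform 1%:M v v) _.
    by rewrite mulr_gt0 // bform1_gt0.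
  rewrite (bigD1 i0) //= -[leLHS]addr0 lerD //.
  by rewrite sumr_ge0 // => i _; apply: (Ap i).2.
exists (fun i => (invmx U)^T *m A i *m invmx U), (fun j => U *m B j *m U^T).
have conjE (M : 'M[R]_r) v : bform ((invmx U)^T *m M *m invmx U) v v
    = bform M (v *m (invmx U)^T) (v *m (invmx U)^T).
  by rewrite /bform trmx_mul trmxK !mulmxA.
have normE v : bform W (v *m (invmx U)^T) (v *m (invmx U)^T)
    = bform 1%:M v v.
  rewrite -conjE UE -!mulmxA mulmxV // mulmx1 -trmx_mul mulmxV // trmx1 //.
split; split.
- by move=> i; apply: psdmx_conj.
- by move=> j; have := psdmx_conj U^T (Bp j); rewrite trmxK.
- move=> i j; rewrite -!mulmxA mxtrace_mulC !mulmxA mulmxKV //.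
  by rewrite -[_ *m U^T *m _]mulmxA -trmx_mul mulVmx // trmx1 mulmx1.
(* The new trace is [\tr (W *m B j)]: the mean of the [A i] contributes at most 2, and each of the
   [r] rows of [Z], being dominated, at most [2 / r]. *)
- move=> j; rewrite -mulmxA mxtrace_mulC -mulmxA -UE mxtrace_mulC.
  rewrite /W mulmxDl -!scalemxAl raddfD /= !mxtraceZ.
  rewrite (_ : 4 = 2 + 2); last by ring.
  apply: lerD; rewrite ler_pdivrMl //.
    rewrite mulmx_suml raddf_sum mulr_natl -sumr_const.
    by apply: ler_sum => i _; exact: AB2.
  have -> : Z^T *m Z = \sum_k (row k Z)^T *m row k Z.
    apply/matrixP => a b; rewrite mxE summxE; apply: eq_bigr => k _.
    by rewrite [RHS]mxE big_ord1 !mxE.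
  rewrite mulmx_suml raddf_sum mulr_natl -[in leRHS](card_ord r) -sumr_const.
  apply: ler_sum => k _; have [i dom] := Zdom k.
  apply: le_trans (AB2 i j); apply: mxtrace_psd_le => // w.
  by apply: le_trans (dom w); rewrite bform_gram big_ord1 row_id.
- move=> i v; rewrite conjE -normE; apply: le_trans (AZ _ _) _.
  rewrite (_ : 4 * r%:R ^+ 2 * _ = 4 * r%:R * (r%:R * bform W
    (v *m (invmx U)^T) (v *m (invmx U)^T))); last by ring.
  by apply: ler_wpM2l; rewrite ?mulr_ge0.
- move=> v; rewrite -mulmx_suml -mulmx_sumr conjE -normE; exact: WA.
Qed.

(** * The lower bound from a pseudo-density *)

Lemma cube_mean_restrict (R : realType) (n m : nat) (S : msubset n m)
    (g : cube m -> R) :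
  cube_mean (fun x : cube n => g (restrict S x)) = cube_mean g.
Proof.
rewrite (cube_mean_merge S); under cube_mean_ext => z.
  under cube_mean_ext do rewrite restrict_merge.
  over.
by rewrite cube_mean_cst.
Qed.

(* Adding a small multiple of the identity to the A_S makes them definite, as
   psd_scaling requires, without losing the strict inequality on D. *)
Lemma psd_factor_growth (R : realType) (n m d r k : nat) (f D : cube m -> R)
    (N tau eps : R) :
  (0 < r)%N -> (0 < n)%N -> (m <= n)%N -> (forall y, 0 <= f y <= 1) ->
  pseudo_density d D -> 0 < N -> (forall y, `|D y| <= N) -> 0 < tau <= 1 ->
  0 < eps -> cube_mean (fun y => D y * f y) < - eps ->
  psd_factor (pattern_mx f n) r ->
  (1 + eps / (N * 4)) ^+ (k * 2) * (eps / N)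
    <= 4 * (1 + (tau + 2 / tau * (4 * r%:R ^+ 2 *
         ((k * m * m)%:R / n%:R) ^+ (d./2).+1))) ^+ (k * 2) * r%:R.
Proof.
move=> r0 n0 mn f01 Dd N0 DN taub eps0 corr [A [B [Ap [Bp AB]]]].
have c0 := card_msubset_gt0 R mn.
have /card_gt0P[S0 _] : (0 < #|msubset n m|)%N by move: c0; rewrite ltr0n.
have trB0 x : 0 <= \tr (B x).
  by rewrite -[B x]mul1mx; apply: mxtrace_psdM_ge0 => //; apply: psdmx1.
pose beta := 1 + \sum_x \tr (B x).
have trB x : \tr (B x) <= beta.
  by rewrite /beta (bigD1 x) //= addrCA lerDl addr_ge0 // sumr_ge0.
have beta0 : 0 < beta by rewrite ltr_wpDr // sumr_ge0.
pose gap := - eps - cube_mean (fun y => D y * f y).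
have gap0 : 0 < gap by rewrite subr_gt0.
(* The first bound keeps the perturbed entries at most 2; the second lets the perturbation use at
   most half of [gap]. *)
pose delta := Num.min beta^-1 (gap / (2 * N * beta)).
have delta0 : 0 < delta.
  by rewrite lt_min invr_gt0 beta0 divr_gt0 // !mulr_gt0.
have delta_beta : delta * beta <= 1.
  by rewrite -ler_pdivlMr // mul1r ge_min lexx.
have delta_gap : delta * beta * N < gap.
  apply: (@le_lt_trans _ _ (gap / 2)); last by lra.
  have : delta <= gap / (2 * N * beta) by rewrite ge_min lexx orbT.
  rewrite ler_pdivlMr ?mulr_gt0 // => h; lra.
pose A1 S := A S + delta *: 1%:M.
have tr1 S x : \tr (A1 S *m B x) = f (restrict S x) + delta * \tr (B x).
  by rewrite mulmxDl raddfD /= -AB -scalemxAl mul1mx mxtraceZ.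
have A1p S : psdmx (A1 S).
  by apply: psdmxD => //; apply: psdmxZ; [exact: ltW|exact: psdmx1].
have A1delta S v : delta * bform 1%:M v v <= bform (A1 S) v v.
  by rewrite bformE_add bformE_scale lerDr; apply: (Ap S).2.
have tr2 S x : \tr (A1 S *m B x) <= 2.
  rewrite tr1 (_ : 2 = 1 + 1); last by ring.
  apply: lerD; first by case/andP: (f01 (restrict S x)).
  by apply: le_trans delta_beta; rewrite ler_wpM2l // ltW.
have [A' [B' [[A'p B'p A'B'] [B'4 A'M A'sum]]]] :=
  psd_scaling S0 r0 A1p Bp delta0 A1delta tr2.
have M0 : 0 <= 4 * r%:R ^+ 2 :> R by rewrite mulr_ge0 // exprn_ge0.
apply: (psd_rank_growth k n0 mn Dd N0 DN taub M0 A'p A'M A'sum B'p B'4) => //.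
have -> : cube_mean (fun x => \tr (mean_op D A' x *m B' x))
    = #|msubset n m|%:R^-1 * \sum_S (cube_mean (fun y => D y * f y)
        + cube_mean (fun x => D (restrict S x) * (delta * \tr (B x)))).
  under [in RHS]eq_bigr => S _.
    rewrite -(cube_mean_restrict S) -cube_meanD.
    over.
  rewrite -cube_mean_sum -cube_meanZ; apply: cube_mean_ext => x.
  rewrite /mean_op -scalemxAl mxtraceZ mulmx_suml raddf_sum /=.
  congr (_ * _); apply: eq_bigr => S _.
  by rewrite -scalemxAl mxtraceZ A'B' tr1 mulrDr.
rewrite ltr_pdivrMl //.
have le1 S : cube_mean (fun y => D y * f y)
    + cube_mean (fun x => D (restrict S x) * (delta * \tr (B x)))
    <= cube_mean (fun y => D y * f y) + delta * beta * N.
  rewrite lerD2l -(cube_mean_cst n (delta * beta * N)).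
  apply: ler_cube_mean => x; apply: le_trans (ler_norm _) _.
  have dB0 : 0 <= delta * \tr (B x) by rewrite mulr_ge0 // ltW.
  rewrite normrM [X in _ * X]ger0_norm // mulrC.
  apply: ler_pM => //; by rewrite ler_wpM2l // ltW.
apply: le_lt_trans (ler_sum _ (fun S _ => le1 S)) _.
rewrite sumr_const -[_ *+ _]mulr_natl ltr_pM2l //.
by move: delta_gap; rewrite /gap; lra.
Qed.

Lemma cube_maxnorm_ge (R : realType) (m : nat) (D : cube m -> R) (y : cube m) :
  `|D y| <= cube_maxnorm D.
Proof. exact: le_bigmax. Qed.

Lemma cube_maxnorm_ge1 (R : realType) (m d : nat) (D : cube m -> R) :
  pseudo_density d D -> 1 <= cube_maxnorm D.
Proof.
case=> <- _; rewrite -(cube_mean_cst m (cube_maxnorm D)).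
apply: ler_cube_mean => y; exact: le_trans (ler_norm _) (cube_maxnorm_ge D y).
Qed.

(** * Numerical estimates *)

(** From [1 - x <= expR (- x)] and [(1 - x) (1 + 2 x) >= 1] on this range. *)
Lemma expR_le_1D2 (R : realType) (x : R) : 0 <= x <= 1 / 2 ->
  expR x <= 1 + 2 * x.
Proof.
move=> /andP[x0 x1]; have := expR_ge1Dx (- x); rewrite expRN => h.
have e0 := expR_gt0 x.
have : (1 - x) * expR x <= 1 by rewrite -ler_pdivlMr // div1r.
nra.
Qed.

Lemma ln_ge_half (R : realType) (n : nat) : (1 < n)%N -> 1 / 2 <= ln (n%:R : R).
Proof.
move=> n1; rewrite -[leLHS]expRK ler_ln ?posrE ?expR_gt0 ?ltr0n ?(ltnW n1) //.
apply: (@le_trans _ _ 2); last by rewrite ler_nat.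
by apply: le_trans (expR_le_1D2 _) _; lra.
Qed.

(** A factorization of size 0 has zero entries only; as an [m]-set exists, [f] and its correlation
    with [D] would vanish. *)
Lemma psd_factor_gt0 (R : realType) (n m r : nat) (f D : cube m -> R)
    (eps : R) : (m <= n)%N -> 0 < eps ->
  cube_mean (fun y => D y * f y) < - eps ->
  psd_factor (pattern_mx f n) r -> (0 < r)%N.
Proof.
move=> mn eps0 corr [A [B [_ [_ AB]]]]; rewrite lt0n; apply: contraTneq corr.
move=> r0; have /card_gt0P[S _] : (0 < #|msubset n m|)%N.
  by rewrite -(ltr0n R); apply: card_msubset_gt0.
rewrite -leNgt -(cube_mean_restrict S) (@cube_mean_ext _ _ _ (fun=> 0)).
  by rewrite cube_mean_cst oppr_le0 ltW.
move=> x; have := AB S x; rewrite /pattern_mx => ->; subst r.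
by rewrite [\tr _]big_ord0 mulr0.
Qed.

(** The factor [(1 + delta) ^+ K] is cancelled by means of [(1 + e / 16) (1 + e / 8) <= 1 + e / 4],
    valid for [e <= 1]. *)
Lemma growth_ratio (R : realType) (K : nat) (e delta r : R) :
  0 < e <= 1 -> 0 <= delta <= e / 16 -> 0 <= r ->
  (1 + e / 4) ^+ K * e <= 4 * (1 + delta) ^+ K * r ->
  (1 + e / 8) ^+ K * e <= 4 * r.
Proof.
move=> /andP[e0 e1] /andP[delta0 delta1] r0 grow.
have s1 : 0 < (1 + e / 16) ^+ K by rewrite exprn_gt0 //; lra.
rewrite -(ler_pM2l s1) mulrA -exprMn.
apply: (@le_trans _ _ ((1 + e / 4) ^+ K * e)).
  apply: ler_wpM2r; first exact: ltW.
  have -> : (1 + e / 16) * (1 + e / 8) = 1 + e / 16 * (3 + e / 8) by field.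
  apply: lerXn2r; rewrite ?nnegrE; [nra|lra|].
  have : e / 16 * (3 + e / 8) <= e / 16 * 4 by apply: ler_wpM2l; lra.
  by lra.
apply: le_trans grow _; rewrite [leRHS]mulrCA -mulrA ler_wpM2l //.
by apply: ler_wpM2r => //; apply: lerXn2r; rewrite ?nnegrE; lra.
Qed.

(** Since [expR (e / 16) <= 1 + e / 8], it suffices to compare exponents. *)
Lemma expn_le_growth (R : realType) (n d k : nat) (e : R) :
  (0 < n)%N -> 0 < e <= 1 -> 16 * d%:R * ln n%:R <= k%:R * e ->
  (n%:R : R) ^+ (d * 2) <= (1 + e / 8) ^+ (k * 2).
Proof.
move=> n0 /andP[e0 e1] ke.
apply: (@le_trans _ _ (expR (e / 16) ^+ (k * 2))).
  have -> : (n%:R : R) = expR (ln n%:R) by rewrite lnK // posrE ltr0n.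
  by rewrite -!expRM_natl ler_expR !natrM; lra.
have -> : e / 8 = 2 * (e / 16) by field.
apply: lerXn2r; rewrite ?nnegrE ?expR_ge0; first by [].
  by lra.
by apply: expR_le_1D2; apply/andP; split; lra.
Qed.

(* The growth inequality fails for 2k of order (N/eps) d ln n as soon as
   r^2 (k m^2/n)^(d/2) is small compared with (eps/N)^2. *)
Lemma rank_growth_absurd (R : realType) (n m d r : nat) (e : R) :
  (1 <= m)%N -> (1 <= d)%N -> (2 * m <= n)%N -> (0 < r)%N -> 0 < e <= 1 ->
  (forall k, (1 + e / 4) ^+ (k * 2) * e
    <= 4 * (1 + (e / 32 + 2 / (e / 32) * (4 * r%:R ^+ 2 *
         ((k * m * m)%:R / n%:R) ^+ (d./2).+1))) ^+ (k * 2) * r%:R) ->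
  ((2 ^+ 18)^-1 * e * n%:R / (d%:R * m%:R ^+ 2 * ln n%:R)) `^ (d%:R / 4) * e
    <= r%:R.
Proof.
move=> m1 d1 mn r0 /andP[e0 e1] growth; rewrite leNgt; apply/negP.
set beta := _ * e * _ / _; set b := beta `^ _ => rb.
have n1 : (1 < n)%N by apply: leq_trans mn; rewrite mul2n -addnn (leq_add m1 m1).
have n0R : 0 < n%:R :> R by rewrite ltr0n ltnW.
have n2R : 2 <= n%:R :> R by rewrite ler_nat.
have m1R : 1 <= m%:R :> R by rewrite ler1n.
have d1R : 1 <= d%:R :> R by rewrite ler1n.
have r1R : 1 <= r%:R :> R by rewrite ler1n.
have L2 := ln_ge_half R n1; set L := ln n%:R in L2 beta b rb.
have den : 1 / 2 <= d%:R * m%:R ^+ 2 * L.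
  have : 1 <= d%:R * m%:R ^+ 2 :> R by rewrite mulr_ege1 // exprn_ege1.
  by nra.
have den0 : 0 < d%:R * m%:R ^+ 2 * L by apply: lt_le_trans den; lra.
have beta_ge0 : 0 <= beta.
  by rewrite /beta divr_ge0 ?(ltW den0) // !mulr_ge0 ?invr_ge0 ?(ltW e0).
(* Under the assumption [r < b e] to be refuted, [r >= 1] and [e <= 1] force [b > 1], hence
   [beta > 1]; powers of [beta] then increase with the exponent. *)
have b_gt1 : 1 < b.
  apply: le_lt_trans r1R _; apply: lt_le_trans rb _.
  by rewrite ler_piMr // powR_ge0.
have beta_gt1 : 1 < beta.
  rewrite ltNge; apply: contraTN b_gt1 => beta1; rewrite -leNgt /b.
  rewrite [leRHS](_ : 1 = 1 `^ (d%:R / 4)); last by rewrite powR1.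
  by rewrite ge0_ler_powR ?nnegrE // divr_ge0.
have beta0 : 0 < beta by apply: lt_trans beta_gt1.
have beta_le : beta <= n%:R / 4.
  rewrite /beta ler_pdivrMr //.
  have : (2 ^+ 18)^-1 * e <= 1 / 8 by lra.
  have : (n%:R : R) / 8 <= n%:R / 4 * (d%:R * m%:R ^+ 2 * L) by nra.
  by move=> h1 h2; apply: le_trans h1; nra.
have b_le : b <= beta ^+ d.
  rewrite -powR_mulrn // /b; apply: ler_powR; first exact: ltW.
  by lra.
have b2_le : b ^+ 2 <= beta ^+ (d./2).+1.
  rewrite -[beta ^+ _]powR_mulrn // -[b ^+ 2]powR_mulrn ?powR_ge0 // -powRrM.
  apply: ler_powR.
    exact: ltW.
  have : (d%:R : R) <= 2 * (d./2).+1%:R.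
    rewrite -natrM ler_nat mul2n -[leqLHS]odd_double_half doubleS -addn2 addnC.
    by rewrite leq_add2l; case: (odd d).
  by lra.
(* [k > x] is what [expn_le_growth] asks for; since [x >= 1], rounding up costs at most a factor
   2. *)
pose x := 16 * d%:R * L / e.
have x8 : 8 <= x by rewrite ler_pdivlMr //; nra.
pose k := (Num.truncn x).+1.
have /andP[kx xk] : (Num.truncn x)%:R <= x < k%:R.
  by apply: truncn_itv; lra.
have k2x : k%:R <= 2 * x by rewrite /k -natr1; lra.
(* For [k <= 2 x] the ratio [k m^2 / n] is at most [2^5 d m^2 L / (e n)], that is [2^5 / 2^18]
   divided by [beta]. Also [256 * kappa = 1 / 32], which is used to bound [delta]. *)
pose kappa : R := (2 ^+ 13)^-1.
have q_le : (k * m * m)%:R / n%:R <= kappa / beta.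
  rewrite ler_pdivrMr // !natrM.
  have m0R : 0 < m%:R :> R by rewrite ltr0n.
  have d0R : 0 < d%:R :> R by rewrite ltr0n.
  have L0 : 0 < L by apply: lt_le_trans L2; rewrite divr_gt0.
  have -> : kappa / beta * n%:R = 2 * x * m%:R * m%:R.
    by rewrite /kappa /beta /x; field; rewrite !gt_eqF.
  by rewrite !ler_wpM2r.
have := growth k; set q := (_ / n%:R) ^+ _.
have km0 : 0 <= (k * m * m)%:R / n%:R :> R by rewrite divr_ge0.
have q0 : 0 <= q by rewrite exprn_ge0 // divr_ge0.
have rq : r%:R ^+ 2 * q <= e ^+ 2 * kappa.
  have r2 : r%:R ^+ 2 <= b ^+ 2 * e ^+ 2.
    by rewrite -exprMn ler_sqr ?nnegrE // ?mulr_ge0 ?powR_ge0 // ltW.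
  have q2 : q <= (kappa / beta) ^+ (d./2).+1.
    by rewrite lerXn2r // nnegrE //; exact: le_trans q_le.
  apply: (@le_trans _ _ ((beta ^+ (d./2).+1 * e ^+ 2)
      * (kappa / beta) ^+ (d./2).+1)).
    apply: ler_pM => //.
    by apply: le_trans r2 _; rewrite ler_wpM2r // exprn_ge0 // ltW.
  rewrite mulrC mulrA -exprMn divfK ?gt_eqF // mulrC ler_wpM2l ?sqr_ge0 //.
  rewrite exprS ler_piMr ?invr_ge0 ?exprn_ge0 // exprn_ile1 //.
    by rewrite invr_ge0 exprn_ge0.
  by rewrite invf_le1 ?exprn_gt0 // exprn_ege1 // ler1n.
set delta := e / 32 + _.
have delta_le : delta <= e / 16.
  rewrite /delta.
  have -> : 2 / (e / 32) * (4 * r%:R ^+ 2 * q) = 256 / e * (r%:R ^+ 2 * q).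
    by field; rewrite gt_eqF.
  have : 256 / e * (r%:R ^+ 2 * q) <= e / 32.
    have e256 : 0 <= 256 / e by apply: divr_ge0; [exact: ler0n|exact: ltW].
    apply: le_trans (ler_wpM2l e256 rq) _.
    have -> : 256 / e * (e ^+ 2 * kappa) = e / 32; last by [].
    by rewrite /kappa; field; rewrite gt_eqF.
  move: (256 / e * _) => y; clear - e0; lra.
have delta0 : 0 <= delta.
  have e32 : 0 < e / 32 by rewrite divr_gt0.
  apply: addr_ge0; first exact: ltW.
  by apply: mulr_ge0; [rewrite divr_ge0 // ltW|rewrite !mulr_ge0].
move=> grow.
have grow1 : (1 + e / 8) ^+ (k * 2) * e <= 4 * r%:R.
  by apply: growth_ratio grow; rewrite ?e0 ?delta0.
have grow2 : (n%:R : R) ^+ (d * 2) <= (1 + e / 8) ^+ (k * 2).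
  apply: expn_le_growth; [exact: ltnW|by rewrite e0|].
  by rewrite -ler_pdivrMr // ltW.
(* The growth bound and [r < b e] squeeze [n ^ (2 d)] below [4 beta ^ d], which [beta <= n / 4]
   excludes. *)
have : (n%:R : R) ^+ (d * 2) < 4 * beta ^+ d.
  rewrite -(ltr_pM2r e0); apply: le_lt_trans (ler_wpM2r (ltW e0) grow2) _.
  apply: le_lt_trans grow1 _; rewrite -mulrA ltr_pM2l //.
  by apply: lt_le_trans rb _; rewrite ler_wpM2r // ltW.
apply/negP; rewrite -leNgt.
apply: (@le_trans _ _ (4 * (n%:R / 4) ^+ d)).
  by apply: ler_wpM2l => //; apply: lerXn2r => //; rewrite nnegrE.
rewrite expr_div_n muln2 -addnn exprD mulrCA ler_wpM2l ?exprn_ge0 //.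
rewrite -{1}[d]prednK // exprS invfM mulrA divff ?mul1r ?pnatr_eq0 //.
apply: (@le_trans _ _ 1); last by rewrite exprn_ege1 // ler1n ltnW.
by rewrite invf_le1 ?exprn_gt0 // exprn_ege1 // ler1n.
Qed.

(** * Duality for sums of squares *)

Lemma sum_continuous (R : realType) (T : topologicalType) (I : Type)
    (s : seq I) (F : I -> T -> R) :
  (forall i, continuous (F i)) -> continuous (fun v => \sum_(i <- s) F i v).
Proof.
move=> Fc; elim: s => [|i s IH].
  rewrite (_ : (fun _ => _) = (fun=> 0)); first exact: cst_continuous.
  by apply/funext => v; rewrite big_nil.
rewrite (_ : (fun _ => _) = (fun v => F i v + \sum_(j <- s) F j v)).
  by move=> v; apply: (@continuousD R R T (F i)); [exact: Fc|exact: IH].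
by apply/funext => v; rewrite big_cons.
Qed.

Lemma sqr_continuous (R : realType) (T : topologicalType) (F : T -> R) :
  continuous F -> continuous (fun v => F v ^+ 2).
Proof.
move=> Fc v; rewrite (_ : (fun _ => _) = F \* F); last exact/funext.
by apply: continuousM; exact: Fc.
Qed.

Lemma min_on_box (R : realType) (N : nat) (b : R) (F : 'rV[R]_N -> R) :
  0 <= b -> continuous F ->
  exists2 c : 'rV[R]_N, forall i, `|c 0 i| <= b &
    forall v : 'rV[R]_N, (forall i, `|v 0 i| <= b) -> F c <= F v.
Proof.
move=> b0 Fc; pose A := [set v : 'rV[R]_N | forall i, `[- b, b]%classic (v 0 i)]%classic.
have A0 : (A !=set0)%classic.
  by exists 0 => i; rewrite /= mxE in_itv /= b0 oppr_le0 b0.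
have Ac : compact A.
  by apply: (@rV_compact R N (fun=> `[- b, b]%classic)) => i; apply: segment_compact.
have [c cA cmin] := EVT_min_rV A0 Ac (continuous_subspaceT Fc).
have AE (v : 'rV[R]_N) : v \in A <-> forall i, `|v 0 i| <= b.
  split=> [/set_mem vA i|vA]; first by have := vA i; rewrite /= in_itv /= ler_norml.
  by apply/mem_set => i; rewrite /= in_itv /= -ler_norml.
by exists c => [|v vb]; [apply/AE|apply/cmin/AE].
Qed.

Definition small_sets (m k : nat) : {set {set 'I_m}} :=
  [set T : {set 'I_m} | (#|T| <= k)%N].

Definition chi_row (R : realType) (m k : nat) (x : cube m) :
    'rV[R]_#|small_sets m k| :=
  \row_a chi R (enum_val a) x.

(** For psd [Q] these are exactly the sums of squares of functions of degree at most [k], so that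
    this cone is parametrized by matrices of a fixed size. *)
Definition gram_fun (R : realType) (m k : nat)
    (Q : 'M[R]_#|small_sets m k|) (x : cube m) : R :=
  bform Q (chi_row R k x) (chi_row R k x).

Lemma fourier_small (R : realType) (m k : nat) (c : 'rV[R]_#|small_sets m k|)
    (x : cube m) :
  (c *m (chi_row R k x)^T) 0 0 = \sum_(a < #|small_sets m k|)
    c 0 a * chi R (enum_val a) x.
Proof. by rewrite mxE; apply: eq_bigr => a _; rewrite !mxE. Qed.

Lemma fdeg_small (R : realType) (m k : nat) (h : cube m -> R) : fdeg_le k h ->
  exists c : 'rV[R]_#|small_sets m k|,
    forall x, h x = (c *m (chi_row R k x)^T) 0 0.
Proof.
move=> hk; exists (\row_a fourier h (enum_val a)) => x.
rewrite fourier_small fourierK (bigID (mem (small_sets m k))) /=.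
rewrite [X in _ + X]big1 ?addr0 => [|U]; last first.
  by rewrite inE -ltnNge => /hk ->; rewrite mul0r.
by rewrite big_enum_val; apply: eq_bigr => a _; rewrite mxE.
Qed.

Lemma fdeg_le_small (R : realType) (m k : nat) (c : 'rV[R]_#|small_sets m k|) :
  fdeg_le k (fun x => (c *m (chi_row R k x)^T) 0 0).
Proof.
apply: (@fdeg_le_ext _ _ _ (fun x => \sum_(a < #|small_sets m k|)
    c 0 a * chi R (enum_val a) x)) => [x|]; first by rewrite fourier_small.
apply: fdeg_le_sum => a _; apply: fdeg_leZ.
by apply: (fdeg_leW _ (@fdeg_le_chi _ _ _)); have := enum_valP a; rewrite inE.
Qed.

Lemma gram_funE (R : realType) (m k q : nat)
    (V : 'M[R]_(q, #|small_sets m k|)) (x : cube m) :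
  gram_fun (V^T *m V) x = \sum_i (row i V *m (chi_row R k x)^T) 0 0 ^+ 2.
Proof. exact: bform_gram. Qed.

Lemma has_sos_gram (R : realType) (m d : nat) (Q : 'M[R]_#|small_sets m d./2|) :
  psdmx Q -> has_sos (gram_fun Q) d.
Proof.
move=> /psdmx_gramP[V ->]; exists #|small_sets m d./2|.
exists (fun i x => (row i V *m (chi_row R d./2 x)^T) 0 0); split=> [i|x].
  rewrite mul2n -geq_half_double; apply/fdeg_leP; exact: fdeg_le_small.
exact: gram_funE.
Qed.

(* By Parseval the mean of the Gram function of V^T V is the squared Frobenius
   norm of V, so only bounded V compete. *)
Lemma mean_gram_fun (R : realType) (m k q : nat)
    (V : 'M[R]_(q, #|small_sets m k|)) :
  cube_mean (gram_fun (V^T *m V)) = \sum_i \sum_a V i a ^+ 2.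
Proof.
under cube_mean_ext do rewrite gram_funE.
rewrite cube_mean_sum; apply: eq_bigr => i _.
(* Extends row [i] of [V] by zero from the small sets to all sets. *)
pose c (U : {set 'I_m}) := \sum_(a | enum_val a == U) V i a.
have cE a : c (enum_val a) = V i a.
  rewrite /c (eq_bigl (pred1 a)) ?big_pred1_eq // => a' /=.
  by rewrite (inj_eq enum_val_inj).
under cube_mean_ext => x.
  rewrite fourier_small.
  under eq_bigr do rewrite mxE -cE.
  rewrite -(big_enum_val (fun U => c U * chi R U x)).
  over.
by rewrite parseval_sum big_enum_val; apply: eq_bigr => a _; rewrite cE.
Qed.

(** Minimising over Gram factors [V] instead of [Q] removes the psd constraint, and comparison with
    [V = 0] confines the competitors to a compact box. *)
Lemma nearest_gram (R : realType) (m k : nat) (f : cube m -> R) :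
  (forall x, 0 <= f x <= 1) ->
  exists2 Q : 'M[R]_#|small_sets m k|, psdmx Q &
    forall Q' : 'M[R]_#|small_sets m k|, psdmx Q' ->
      \sum_x (f x - gram_fun Q x) ^+ 2 <= \sum_x (f x - gram_fun Q' x) ^+ 2.
Proof.
move=> f01; set p := #|small_sets m k|.
pose G (v : 'rV[R]_(p * p)) : cube m -> R :=
  gram_fun ((vec_mx v)^T *m vec_mx v).
pose F v := \sum_x (f x - G v x) ^+ 2.
have GE v x : G v x = \sum_i (\sum_a v 0 (mxvec_index i a)
    * chi R (enum_val a) x) ^+ 2.
  rewrite /G gram_funE; apply: eq_bigr => i _; rewrite fourier_small.
  by congr (_ ^+ 2); apply: eq_bigr => a _; rewrite !mxE.
have Fc : continuous F.
  apply: sum_continuous => x; apply: sqr_continuous => v.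
  apply: (@continuousD R R _ (cst (f x)) (fun v => - G v x)).
    exact: cst_continuous.
  apply: continuousN; rewrite (_ : (fun v => G v x) = (fun v => \sum_i (\sum_a
      v 0 (mxvec_index i a) * chi R (enum_val a) x) ^+ 2)); last first.
    by apply/funext => w; exact: GE.
  move: v; apply: sum_continuous => i; apply: sqr_continuous.
  apply: sum_continuous => a v.
  apply: (@continuousM R _ (fun v : 'rV[R]_(p * p) => v 0 (mxvec_index i a))
    (cst (chi R (enum_val a) x))); [exact: coord_continuous|].
  exact: cst_continuous.
have [c _ cmin] := min_on_box (ler0n R 3) Fc.
exists ((vec_mx c)^T *m vec_mx c) => [|Q' /psdmx_gramP[V ->]].
  exact: psdmx_gram.
pose v := mxvec V; have VE : V = vec_mx v by rewrite mxvecK.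
rewrite VE -/(F c) -/(F v).
have F0 : F 0 <= #|cube m|%:R.
  have -> : #|cube m|%:R = \sum_(x : cube m) 1 :> R by rewrite sumr_const.
  apply: ler_sum => x _.
  rewrite GE big1 => [|i _]; last first.
    by rewrite big1 ?expr0n // => a _; rewrite mxE mul0r.
  have /andP[f0 f1] := f01 x.
  by rewrite subr0 expr_le1.
have [vF|Fv] := ltP (F 0) (F v).
  apply: le_trans (ltW vF); apply: cmin => i; by rewrite mxE normr0.
apply: cmin => j; case/mxvec_indexP: j => i a.
(* For [0 <= y <= 1] one has [z <= 3 + 2 (y - z) ^+ 2], and the mean of these squares is at most 1
   because [F v <= F 0]. Each entry then has square at most 5, within the box of radius 3. *)
have : cube_mean (G v) <= 5.
  rewrite ler_pdivrMr ?card_cube_gt0 //.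
  apply: (@le_trans _ _ (\sum_x (3 + 2 * (f x - G v x) ^+ 2))).
    apply: ler_sum => x _; have /andP[f0 f1] := f01 x.
    by move: (f x) (G v x) f0 f1 => y z; have := sqr_ge0 (y - z + 1);
      have := sqr_ge0 (y - z); nra.
  rewrite big_split /= -mulr_sumr sumr_const -[3 *+ _]mulr_natr -/(F v).
  have := le_trans Fv F0; lra.
rewrite mean_gram_fun (bigD1 i) //= (bigD1 a) //= -addrA => h.
have : v 0 (mxvec_index i a) ^+ 2 <= 3 ^+ 2.
  have -> : v 0 (mxvec_index i a) = vec_mx v i a by rewrite mxE.
  apply: le_trans (_ : 5 <= _); last by lra.
  apply: le_trans h; rewrite lerDl addr_ge0 // sumr_ge0 // => *.
    by rewrite sqr_ge0.
  by rewrite sumr_ge0 // => *; rewrite sqr_ge0.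
by rewrite -[_ ^+ 2]real_normK ?num_real // ler_sqr // nnegrE.
Qed.

(** A one-sided derivative test at 0: for [a < 0] the value at [t = - a / (s + 1 - a)], which lies
    in the interval, would be negative. *)
Lemma small_step_ge0 (R : realType) (a s : R) : 0 <= s ->
  (forall t, 0 <= t <= 1 -> 0 <= 2 * t * a + t ^+ 2 * s) -> 0 <= a.
Proof.
move=> s0 pos; rewrite leNgt; apply/negP => a0.
have den : 0 < s + 1 - a by lra.
pose t := - a / (s + 1 - a).
have t0 : 0 < t by rewrite divr_gt0 // oppr_gt0.
have t1 : t <= 1 by rewrite ler_pdivrMr //; lra.
have ts : t * (s + 1 - a) = - a by rewrite divfK // gt_eqF.
have := pos t; rewrite (ltW t0) t1 => /(_ isT).
have -> : 2 * t * a + t ^+ 2 * s = t * (2 * a + t * s) by ring.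
rewrite pmulr_rge0 // => h.
have : t * (1 - a) > 0 by rewrite mulr_gt0 //; lra.
by move: ts h; rewrite -addrA mulrDr; lra.
Qed.

(** First-order optimality of the nearest sum of squares [p]: moving [Q] in a psd direction [Q']
    shows that [D0 = p - f] pairs nonnegatively with the cone, and shrinking [Q] that it pairs with
    [p] to at most 0. Its pairing with [f] is then at most [- dist2], negative as [f] is outside the
    cone. *)
Lemma not_sos_pseudo_density (R : realType) (m d : nat) (f : cube m -> R) :
  (forall x, 0 <= f x <= 1) -> ~ has_sos f d ->
  exists D : cube m -> R, pseudo_density d D /\
    cube_mean (fun x => D x * f x) < 0.
Proof.
move=> f01 nsos; have [Q Qp Qmin] := nearest_gram d./2 f01.
pose p x := gram_fun Q x; pose D0 x := p x - f x.
pose dist2 := \sum_x D0 x ^+ 2.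
have distE : dist2 = \sum_x (f x - p x) ^+ 2.
  by apply: eq_bigr => x _; rewrite /D0 -sqrrN opprB.
have gramD t Q' x : gram_fun (Q + t *: Q') x = p x + t * gram_fun Q' x.
  by rewrite /p /gram_fun bformE_add bformE_scale.
have shift (t : R) Q' : psdmx (Q + t *: Q') ->
    0 <= 2 * t * (\sum_x D0 x * gram_fun Q' x)
      + t ^+ 2 * \sum_x gram_fun Q' x ^+ 2.
  move=> /Qmin; rewrite -distE -subr_ge0 /dist2 -sumrB.
  rewrite !mulr_sumr -big_split /=; congr (_ <= _); apply: eq_bigr => x _.
  by rewrite gramD /D0; ring.
have sq0 (Q' : 'M[R]_#|small_sets m d./2|) : 0 <= \sum_x gram_fun Q' x ^+ 2 :> R.
  by rewrite sumr_ge0 // => x _; rewrite sqr_ge0.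
have D0pos (Q' : 'M[R]_#|small_sets m d./2|) : psdmx Q' -> 0 <= \sum_x D0 x * gram_fun Q' x.
  move=> Q'p; apply: (small_step_ge0 (sq0 Q')) => t /andP[t0 _].
  by apply: shift; apply: psdmxD => //; apply: psdmxZ.
have D0p : \sum_x D0 x * p x <= 0.
  rewrite -oppr_ge0; apply: (small_step_ge0 (sq0 Q)) => t /andP[t0 t1].
  have := shift (- t) Q; rewrite sqrrN mulrN mulNr -mulrN; apply.
  rewrite -{1}[Q]scale1r -scalerDl; apply: psdmxZ => //.
  by rewrite subr_ge0.
have dist0 : 0 < dist2.
  rewrite lt_def sumr_ge0 ?andbT => [|x _]; last exact: sqr_ge0.
  apply: contra_notN nsos; rewrite psumr_eq0 => [/allP eq0|x _]; last first.
    exact: sqr_ge0.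
  have fp : f = gram_fun Q.
    apply/funext => x; have := eq0 x (mem_index_enum _).
    by rewrite sqrf_eq0 subr_eq0 => /eqP.
  by rewrite fp; apply: has_sos_gram.
have D0f : cube_mean (fun x => D0 x * f x) < 0.
  rewrite pmulr_llt0 ?invr_gt0 ?card_cube_gt0 //.
  have -> : \sum_x D0 x * f x = \sum_x D0 x * p x - dist2.
    by rewrite -sumrB; apply: eq_bigr => x _; rewrite /D0; ring.
  by lra.
have D0sq g : (2 * cube_deg g <= d)%N -> 0 <= cube_mean (fun x => D0 x * g x ^+ 2).
  move=> gd; rewrite mulr_ge0 ?invr_ge0 //.
  have [|c gc] := @fdeg_small R m d./2 g.
    by apply/fdeg_leP; rewrite geq_half_double -mul2n.
  have := D0pos _ (psdmx_gram c); congr (_ <= _); apply: eq_bigr => x _.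
  by rewrite gram_funE big_ord1 row_id gc.
have D01 : 0 <= cube_mean D0.
  have := D0sq (fun=> 1); under cube_mean_ext do rewrite expr1n mulr1.
  apply; rewrite (_ : cube_deg _ = 0%N) ?muln0 //.
  apply/eqP; rewrite -leqn0; apply/fdeg_leP; exact: fdeg_le_cst.
have f0 : 0 <= cube_mean f by apply: cube_mean_ge0 => x; case/andP: (f01 x).
(* A positive shift makes normalization possible even if [D0] has mean 0; it spends less than half
   of the negative correlation with [f]. *)
pose delta := - cube_mean (fun x => D0 x * f x) / (2 * (cube_mean f + 1)).
have delta0 : 0 < delta by rewrite divr_gt0 ?oppr_gt0 // mulr_gt0 // ltr_wpDl.
have deltaE : delta * (2 * (cube_mean f + 1))
    = - cube_mean (fun x => D0 x * f x).
  by rewrite divfK // mulf_neq0 // gt_eqF // ltr_wpDl.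
pose w := (cube_mean D0 + delta)^-1.
have w0 : 0 < w by rewrite invr_gt0 ltr_wpDl.
exists (fun x => w * (D0 x + delta)); split; [split|] => [|g gd|].
- by rewrite cube_meanZ cube_meanD cube_mean_cst mulVf // gt_eqF // ltr_wpDl.
- under cube_mean_ext do rewrite -mulrA mulrDl.
  rewrite cube_meanZ cube_meanD cube_meanZ mulr_ge0 ?(ltW w0) // addr_ge0 //.
    exact: D0sq.
  by rewrite mulr_ge0 ?(ltW delta0) // cube_mean_ge0 // => x; rewrite sqr_ge0.
- under cube_mean_ext do rewrite -mulrA mulrDl.
  rewrite cube_meanZ cube_meanD cube_meanZ pmulr_rlt0 //.
  by move: deltaE; rewrite mulrCA mulrDr mulr1; lra.
Qed.

(** * The upper bound from a sum-of-squares certificate *)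

(** A nonempty set of size at most [k] is the image of a map from ['I_k]; the empty set accounts for
    the 1. *)
Lemma card_small_sets (n k : nat) : (#|small_sets n k| <= 1 + n ^ k)%N.
Proof.
pose im (f : {ffun 'I_k -> 'I_n}) := [set f i | i : 'I_k].
have sub : small_sets n k \subset set0 |: (im @: [set: {ffun 'I_k -> 'I_n}]).
  apply/subsetP => T; rewrite !inE => Tk.
  have [//|/set0Pn[x0 x0T]] := eqVneq T set0.
  (* Reading past the end of [enum T] returns [x0], itself in [T], so sets with fewer than [k]
     elements are reached too. *)
  apply/imsetP; exists [ffun i : 'I_k => nth x0 (enum T) i]; rewrite ?inE //.
  apply/setP => y; apply/idP/imsetP => [yT|[i _ ->]].
    have yk : (index y (enum T) < k)%N.
      by apply: leq_trans Tk; rewrite cardE index_mem mem_enum.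
    by exists (Ordinal yk) => //; rewrite ffunE nth_index // mem_enum.
  rewrite ffunE; have [iT|Ti] := ltnP i (size (enum T)).
    by rewrite -mem_enum mem_nth.
  by rewrite nth_default.
apply: leq_trans (subset_leq_card sub) _.
apply: leq_trans (leq_card_setU _ _) _; rewrite cards1 leq_add2l.
by apply: leq_trans (leq_imset_card _ _) _; rewrite cardsT card_ffun !card_ord.
Qed.

(** Each [g i] at [x_S] is the product of a coefficient vector depending on [S] with the monomial
    vector of [x]. Its square is the trace of a product of two rank-one matrices, and a single
    matrix for [x] serves all [g i]. *)
Lemma psd_factor_sos (R : realType) (n m d : nat) (f : cube m -> R) :
  has_sos f d -> psd_factor (pattern_mx f n) #|small_sets n d./2|.
Proof.
move=> [q [g [gd fg]]]; set p := #|small_sets n d./2|.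
pose mon (x : cube n) : 'rV[R]_p := \row_(a < p)
  \prod_(i in (enum_val a : {set 'I_n})) (x i)%:R.
(* The coefficients of [g i] transported along [S]; by injectivity at most one [U] contributes to
   each entry. *)
pose c (S : msubset n m) i : 'rV[R]_p := \row_(a < p)
  \sum_(U : {set 'I_m} | (msubset_nth S @: U) == enum_val a) ml_coef (g i) U.
have gE S i x : g i (restrict S x) = (c S i *m (mon x)^T) 0 0.
  rewrite -[LHS](ml_coefK (g i)) mxE.
  have -> : ml_eval (ml_coef (g i)) (restrict S x)
      = \sum_(U : {set 'I_m} | msubset_nth S @: U \in small_sets n d./2)
          ml_coef (g i) U * \prod_(j in msubset_nth S @: U) (x j)%:R.
    rewrite [RHS]big_mkcond; apply: eq_bigr => U _.
    rewrite inE (card_imset _ (@msubset_nth_inj _ _ S)).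
    case: leqP => [_|dU]; last first.
      have gid : (cube_deg (g i) <= d./2)%N by rewrite geq_half_double -mul2n.
      by rewrite ((cube_deg_leP _ _).1 gid _ dU) mul0r.
    rewrite big_imset /=; last by move=> j l _ _; apply: msubset_nth_inj.
    by congr (_ * _); apply: eq_bigr => j _; rewrite ffunE.
  rewrite (partition_big (fun U : {set 'I_m} => msubset_nth S @: U)
    (mem (small_sets n d./2))) //= big_enum_val.
  apply: eq_bigr => a _; rewrite !mxE mulr_suml.
  apply: eq_big => [U|U /andP[_ /eqP ->] //].
  case: eqP => [->|]; rewrite ?andbF // andbT; exact: enum_valP.
exists (fun S => \sum_i (c S i)^T *m c S i), (fun x => (mon x)^T *m mon x).
split=> [S|]; first by apply: psdmx_sum => i _; apply: psdmx_gram.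
split=> [x|S x]; first exact: psdmx_gram.
rewrite /pattern_mx fg mulmx_suml raddf_sum; apply: eq_bigr => i _ /=.
rewrite gE -mulmxA mxtrace_mulC -!mulmxA mulmxA.
rewrite trace_mx11 [RHS]mxE big_ord1 expr2; congr (_ * _).
by rewrite !mxE; apply: eq_bigr => a _; rewrite !mxE mulrC.
Qed.

(** * Bounds on the psd rank of pattern matrices *)

Lemma rk_psdP (R : realType) (n m : nat) (f : cube m -> R) :
  (forall x, 0 <= f x <= 1) ->
  psd_factor (pattern_mx f n) (rk_psd (pattern_mx f n)) /\
  forall r, psd_factor (pattern_mx f n) r -> (rk_psd (pattern_mx f n) <= r)%N.
Proof.
move=> f01; apply: minnatP; apply: psd_factor_ex => S x.
by case/andP: (f01 (restrict S x)).
Qed.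

(** A stronger form of (b), with the quotient [eps / cube_maxnorm D] to the first power. The
    parameter [tau] is this quotient over 32. *)
Lemma rk_psd_ge (R : realType) (m d : nat) (f D : cube m -> R) (eps : R)
    (n : nat) :
  (1 <= m)%N -> (1 <= d)%N -> (forall x, 0 <= f x <= 1) -> 0 < eps <= 1 ->
  pseudo_density d D -> cube_mean (fun x => D x * f x) < - eps ->
  (2 * m <= n)%N ->
  ((2 ^+ 18)^-1 * (eps / cube_maxnorm D) * n%:R
      / (d%:R * m%:R ^+ 2 * ln n%:R)) `^ (d%:R / 4) * (eps / cube_maxnorm D)
    <= (rk_psd (pattern_mx f n))%:R.
Proof.
move=> m1 d1 f01 /andP[eps0 eps1] Dd corr mn.
have N1 := cube_maxnorm_ge1 Dd; set N := cube_maxnorm D in N1 *.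
have N0 : 0 < N by apply: lt_le_trans N1.
have [fac _] := rk_psdP n f01; set r := rk_psd _ in fac *.
have mn' : (m <= n)%N by apply: leq_trans mn; rewrite mul2n -addnn leq_addr.
have n0 : (0 < n)%N by apply: leq_trans mn'.
have r0 := psd_factor_gt0 mn' eps0 corr fac.
have e0 : 0 < eps / N by rewrite divr_gt0.
have e1 : eps / N <= 1 by rewrite ler_pdivrMr // mul1r (le_trans eps1).
apply: rank_growth_absurd => //; first by rewrite e0.
move=> k; have -> : eps / N / 4 = eps / (N * 4) by rewrite invfM mulrA.
apply: (psd_factor_growth k r0 n0 mn' f01 Dd N0 _ _ eps0 corr fac).
  exact: cube_maxnorm_ge.
by apply/andP; split; [rewrite divr_gt0|lra].
Qed.

Lemma ln_nat_gt0 (R : realType) (n : nat) : (1 < n)%N -> 0 < ln (n%:R : R).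
Proof. by move=> n1; apply: lt_le_trans (ln_ge_half R n1); rewrite divr_gt0. Qed.

(** The pseudo-density is fixed before [n], so its norm and its correlation with [f] are absorbed
    into [C]. *)
Lemma rk_psd_lower (R : realType) (m d : nat) (f : cube m -> R) :
  (1 <= m)%N -> (1 <= d)%N -> (forall x, 0 <= f x <= 1) -> ~ has_sos f d ->
  exists C : R, 0 < C /\ forall n, (2 * m <= n)%N ->
    C * (n%:R / ln n%:R) `^ (d%:R / 4) <= (rk_psd (pattern_mx f n))%:R.
Proof.
move=> m1 d1 f01 nsos; have [D [Dd corr]] := not_sos_pseudo_density f01 nsos.
pose eps := Num.min 1 (- cube_mean (fun x => D x * f x) / 2).
have eps01 : 0 < eps <= 1.
  by rewrite ge_min lexx andbT lt_min ltr01 /= divr_gt0 // oppr_gt0.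
have epscorr : cube_mean (fun x => D x * f x) < - eps.
  have : eps <= - cube_mean (fun x => D x * f x) / 2 by rewrite ge_min lexx orbT.
  by lra.
have /andP[eps0 _] := eps01.
have N0 : 0 < cube_maxnorm D by apply: lt_le_trans (cube_maxnorm_ge1 Dd).
have e0 : 0 < eps / cube_maxnorm D by rewrite divr_gt0.
pose C0 : R := (2 ^+ 18)^-1 * (eps / cube_maxnorm D) / (d%:R * m%:R ^+ 2).
have C00 : 0 < C0.
  by rewrite divr_gt0 ?mulr_gt0 ?invr_gt0 ?exprn_gt0 // ltr0n.
exists (C0 `^ (d%:R / 4) * (eps / cube_maxnorm D)); split.
  by rewrite mulr_gt0 // powR_gt0.
move=> n mn; have := rk_psd_ge m1 d1 f01 eps01 Dd epscorr mn.
have n1 : (1 < n)%N by apply: leq_trans mn; rewrite mul2n -addnn (leq_add m1 m1).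
apply: le_trans; rewrite mulrAC -powRM ?(ltW C00) //; last first.
  by rewrite divr_ge0 // ltW // ln_nat_gt0.
rewrite le_eqVlt; apply/orP; left; apply/eqP; congr (_ `^ _ * _).
have := ln_nat_gt0 R n1; move: (ln n%:R) => L L0.
by rewrite /C0 invfM; field; rewrite ?gt_eqF ?ltr0n.
Qed.

Theorem theorem3p8 (R : realType) :
  (forall (m : nat) (f : cube m -> R),
     (1 <= m)%N -> (forall x, 0 <= f x <= 1) ->
     exists C : R, 0 < C /\
       forall d : nat, (1 <= d)%N -> deg_sos f = (d + 2)%N ->
       forall n : nat, (2 * m <= n)%N ->
         (rk_psd (pattern_mx f n))%:R
           <= 1 + (n%:R : R) `^ (1 + d%:R / 2) /\
         C * (n%:R / ln n%:R) `^ (d%:R / 4)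
           <= (rk_psd (pattern_mx f n))%:R)
  /\
  (exists c : R, 0 < c /\
     forall (m d : nat) (f : cube m -> R),
       (1 <= m)%N -> (1 <= d)%N -> (forall x, 0 <= f x <= 1) ->
     forall (eps : R) (D : cube m -> R),
       0 < eps <= 1 -> pseudo_density d D ->
       cube_mean (fun x => D x * f x) < - eps ->
     forall n : nat, (2 * m <= n)%N ->
       (c * eps * n%:R / (d%:R * m%:R ^+ 2 * cube_maxnorm D * ln n%:R))
           `^ (d%:R / 4)
         * (eps / cube_maxnorm D) `^ (3 / 2)
         * Num.sqrt (cube_mean f)
       <= (rk_psd (pattern_mx f n))%:R).
Proof.
split=> [m f m1 f01|].
  have f0 x : 0 <= f x by case/andP: (f01 x).
  have [sos_deg deg_min] := minnatP (has_sos_ex f0).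
  (* [C] must be chosen before [d], but [deg_sos f] determines [d]; if no [d >= 1] fits, any
     positive constant will do. *)
  have [[d d1 dE]|nodeg] :=
      pselect (exists2 d, (1 <= d)%N & deg_sos f = (d + 2)%N); last first.
    exists 1; split=> // d d1 dE; case: nodeg; by exists d.
  have nsos : ~ has_sos f d.
    by move=> /deg_min; rewrite -/(deg_sos f) dE addn2 ltnNge leqnSn.
  have [C [C0 lower]] := rk_psd_lower m1 d1 f01 nsos.
  exists C; split=> // d' _; rewrite dE => /addIn <- n mn.
  split; last exact: lower.
  have n1 : (1 < n)%N.
    by apply: leq_trans mn; rewrite mul2n -addnn (leq_add m1 m1).
  have fac := psd_factor_sos n sos_deg; rewrite -/(deg_sos f) dE in fac.
  have /leq_trans := (rk_psdP n f01).2 _ fac => /(_ _ (card_small_sets _ _)).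
  rewrite -(ler_nat R) natrD natrX => /le_trans; apply; rewrite lerD2l.
  rewrite -powR_mulrn // ler_powR ?ler1n ?(ltnW n1) //.
  (* Integer halving rounds down for odd [d], which only lowers the exponent. *)
  rewrite addn2 /= -natr1 addrC lerD2l ler_pdivlMr // -natrM ler_nat muln2.
  by rewrite -{2}(odd_double_half d) leq_addl.
exists (2 ^+ 18)^-1; split; first by rewrite invr_gt0 exprn_gt0.
move=> m d f m1 d1 f01 eps D eps01 Dd corr n mn.
apply: le_trans (rk_psd_ge m1 d1 f01 eps01 Dd corr mn).
have /andP[eps0 eps1] := eps01; have N1 := cube_maxnorm_ge1 Dd.
have N0 : 0 < cube_maxnorm D by apply: lt_le_trans N1.
set e := eps / cube_maxnorm D.
have e0 : 0 < e by rewrite divr_gt0.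
have e1 : e <= 1 by rewrite ler_pdivrMr // mul1r (le_trans eps1).
have -> : (2 ^+ 18)^-1 * eps * n%:R
    / (d%:R * m%:R ^+ 2 * cube_maxnorm D * ln n%:R)
    = (2 ^+ 18)^-1 * e * n%:R / (d%:R * m%:R ^+ 2 * ln n%:R).
  by rewrite /e !invfM; ring.
rewrite -mulrA ler_wpM2l ?powR_ge0 //.
(* As [e <= 1] and [f <= 1], passing to the power [3 / 2] and multiplying by the square root of the
   mean only lower the bound. *)
have e32 : e `^ (3 / 2) <= e.
  by rewrite -[leRHS]powRr1 ?(ltW e0) // ger_powR ?e0 //; lra.
apply: le_trans e32; rewrite ler_piMr ?powR_ge0 //.
rewrite -[leRHS]sqrtr1 ler_wsqrtr // -(cube_mean_cst m 1).
by apply: ler_cube_mean => x; case/andP: (f01 x).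
Qed.
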